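(* If $\{\mathscr{O}_i(x_i^0,\theta_i^0)\}_{i=0}^\infty$ is a compatible sequence of piecewise Fagnano orbits, then the footprint $\mathcal{F}(x_0^0)$, given by the inverse limit $\varprojlim \mathscr{O}_i(x_i^0,\theta_i^0)$, is a topological Cantor set (i.e. a totally disconnected and perfect compact set). Moreover, this inverse limit of the footprints is a self-similar Cantor set.
   Context: Let $KS_0=\Delta$ be the equilateral triangle of side length $1$ with base $I=[0,1]$. For $n\ge 0$, $KS_{n+1}$ is obtained from the polygon $KS_n$ by removing the open middle third (the ghost $g_{n,k}$) of each of its $3\cdot 4^n$ sides $s_{n,k}$ and replacing it by the two other sides of the equilateral triangle erected on it, pointing outward; this triangle is the cell $C_{n+1,k}$ and $g_{n,k}$ is called the ghost of that cell. $\Omega(KS_n)$ is the compact region bounded by $KS_n$, and $KS$ is the limiting Koch snowflake curve. The billiard map $f_n$ on $(KS_n\times S^1)/\sim$ sends a boundary point with inward pointing direction $(x,\theta)$ to $(x^1,\theta^1)$, where $x^1$ is the first point of $KS_n$ hit by the ray from $x$ in direction $\theta$ and $\theta^1$ is the inward direction obtained by reflecting $\theta$ in the side containing $x^1$. The orbit $\mathscr{O}_n(x_n^0,\theta_n^0)$ is the collection of points $(x_n^k,\theta_n^k)=f_n^k(x_n^0,\theta_n^0)$. It is periodic if it is closed and does not hit a vertex; its footprint $\mathcal{F}_n$ is its intersection with $KS_n$, i.e. its Poincaré section. Angles are measured in a fixed coordinate system placed at the base of $KS_0$. A sequence of orbits $\{\mathscr{O}_i(x_i^0,\theta_i^0)\}_{i\ge0}$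 ($\mathscr{O}_i$ an orbit of $\Omega(KS_i)$) is compatible if for every $n$: $\theta_n^0=\theta_0^0$, $x_n^0\in KS_n$ is collinear with $x_0^0$ in the direction $\theta_0^0$, and there are no points of $KS_n$ between $x_n^0$ and $x_0^0$. An orbit of $\Omega(KS_n)$ with initial basepoint $y_n^0\in KS_n$ and inward direction an integer multiple of $\pi/3$ is a piecewise Fagnano orbit if $y_n^0$ is compatible, in that direction, with the midpoint of a ghost $g_{n-1,k}$ of a cell $C_{n,k}$ of $\Omega(KS_n)$ (collinear with it in that direction, with no points of $KS_n$ in between). A compatible sequence of piecewise Fagnano orbits is a compatible sequence of periodic orbits for which there is $N\ge 1$ such that the $n$th orbit is a piecewise Fagnano orbit of $\Omega(KS_n)$ for every $n\ge N$; let $N$ be the least such integer. Such sequences are taken with $x_0^0\in I$ and $\theta_i^0=\pi/3$. Inverse limit. For $n>N$ and an element $(x_n^{k_n},\theta_n^{k_n})$ of $\mathscr{O}_n(x_n^0,\theta_n^0)$, write $k_n=2\zeta_n+\beta_n$ with $\beta_n\in\{1,2\}$ ($\zeta_n$ is the number of pairs of points preceding $x_n^{k_n}$ in the footprint). The transition map is $$F_{n-1,n}(x_n^{k_n},\theta_n^{k_n})=f_{n-1}^{\zeta_n+1}\circ(\tau_{n-1,n}\times\iota_{n-1,n})\circ f_n^{-k_n}(x_n^{k_n},\theta_n^{k_n})=(x_{n-1}^{\zeta_n+1},\theta_{n-1}^{\zeta_n+1}),$$ where $\tau_{n-1,n}$ is truncation of addresses by one character and $\iota_{n-1,n}$ is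 the identity on $S^1$, so that $\tau_{n-1,n}\times\iota_{n-1,n}$ sends $(x_n^0,\theta_n^0)$ to $(x_{n-1}^0,\theta_{n-1}^0)$ (in the address system, sides of $KS_n$ are labelled by words of length $n+1$ over $\{0,1,2,3,4,5\}$, and removing the last character of the label of the side containing $x_n^0$ gives the label of the side containing $x_{n-1}^0$). For $m<n$, $F_{n,m}$ denotes the resulting transition map from level $n$ to level $m$. Then $$\mathcal{F}(x_0^0)=\varprojlim\mathcal{F}_i(x_i^0)=\Big\{(x_i^{k_i},\theta_i^{k_i})_{i=N}^\infty\in\prod_{i=N}^\infty\mathscr{O}_i(x_i^0,\theta_i^0)\ \Big|\ F_{n,m}(x_n^{k_n},\theta_n^{k_n})=(x_m^{k_m},\theta_m^{k_m})\text{ for all }N\le m\le n\Big\},$$ with the inverse limit topology (finite factors discrete). Self-similarity refers to the footprint viewed as a subset of $KS\subseteq\mathbb{R}^2$ (through the limits $\lim_i x_i^{k_i}$). A set is called self-similar if it is the unique fixed point attractor of an iterated function system of contraction (similarity) mappings or, by the paper's convention, if it is the union of finitely many isometric, abutting copies of a given such set. *)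

(* Defs.v *)
From mathcomp Require Import all_boot all_order all_algebra.
From mathcomp Require Import all_classical all_reals all_analysis.

Set Implicit Arguments.
Unset Strict Implicit.
Unset Printing Implicit Defensive.
Import Order.TTheory GRing.Theory Num.Theory.
Import numFieldNormedType.Exports.
Local Open Scope classical_set_scope.
Local Open Scope ring_scope.

Notation plane R := (R * R)%type.

(* An oriented segment, from its first point to its second. *)
Notation side R := (plane R * plane R)%type.

Section Geometry.
Context {R : realType}.
Implicit Types (p q u v : plane R) (s : side R).

Definition dot u v : R := u.1 * v.1 + u.2 * v.2.
Definition cross u v : R := u.1 * v.2 - u.2 * v.1.

(* The product topology of [R * R] comes from the max norm; similarity ratios
   and isometries refer to the Euclidean distance. *)
Definition edist p q : R := Num.sqrt (dot (p - q) (p - q)).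

Definition direction (a : R) : plane R := (cos a, sin a).

Definition side_vector s : plane R := s.2 - s.1.

Definition segment s : set (plane R) :=
  [set p | exists2 t : R, 0 <= t <= 1 & p = s.1 + t *: side_vector s].

Definition midpoint s : plane R := s.1 + 2^-1 *: side_vector s.

Definition rotate_cw60 v : plane R :=
  (v.1 / 2 + Num.sqrt 3 / 2 * v.2, v.2 / 2 - Num.sqrt 3 / 2 * v.1).

(* Reflection of the direction [v] in the line carrying [s]. *)
Definition reflect s v : plane R :=
  (2 * dot v (side_vector s) / dot (side_vector s) (side_vector s))
    *: side_vector s - v.

End Geometry.

Section Snowflake.
Context {R : realType}.
Implicit Types (p x : plane R) (s : side R) (n : nat).

Definition ghost s : side R :=
  (s.1 + 3^-1 *: side_vector s, s.1 + (2 / 3) *: side_vector s).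

(* Polygons are traversed counterclockwise, so the outside lies on the right
   of each side: the apex is the first endpoint of the ghost plus the ghost
   vector turned clockwise. *)
Definition cell_apex s : plane R :=
  (ghost s).1 + rotate_cw60 (side_vector (ghost s)).

Definition refine_side s : seq (side R) :=
  [:: (s.1, (ghost s).1); ((ghost s).1, cell_apex s);
      (cell_apex s, (ghost s).2); ((ghost s).2, s.2)].

Definition triangle_sides : seq (side R) :=
  let A := (0, 0) in let B := (1, 0) in let C := (2^-1, Num.sqrt 3 / 2) in
  [:: (A, B); (B, C); (C, A)].

Fixpoint KS_sides n : seq (side R) :=
  if n is m.+1 then flatten (map refine_side (KS_sides m)) else triangle_sides.

Definition KS n : set (plane R) :=
  [set x | exists2 s, s \in KS_sides n & segment s x].

Definition KS_vertex n : set (plane R) :=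
  [set x | exists2 s, s \in KS_sides n & x = s.1 \/ x = s.2].

(* The limit of the curves [KS n] in the sense of Kuratowski. *)
Definition koch_snowflake : set (plane R) :=
  [set p | exists2 x : nat -> plane R,
    (forall n, KS n (x n)) & x n @[n --> \oo] --> p].

Definition base_segment : set (plane R) :=
  [set x | 0 <= x.1 <= 1 /\ x.2 = 0].

End Snowflake.

(* A basepoint together with a direction, given as a unit vector.  The
   quotient of the phase space is realized by its inward representatives. *)
Notation state R := (plane R * plane R)%type.

Section Billiard.
Context {R : realType}.
Implicit Types (x y p : plane R) (th : plane R) (z w : state R) (n k : nat).

(* With the counterclockwise orientation, a direction is inward when it
   points strictly to the left of the side containing the basepoint.  Only
   basepoints other than vertices matter below. *)
Definition inward_state n : set (state R) :=
  [set z | [/\ dot z.2 z.2 = 1 & exists s,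
    [/\ s \in KS_sides n, segment s z.1 & 0 < cross (side_vector s) z.2]]].

(* [w] is obtained from [z] by following the ray up to the first point of
   [KS n] on it and reflecting in the side containing that point. *)
Definition billiard_step n z w :=
  exists (t : R) s,
    [/\ 0 < t, w.1 = z.1 + t *: z.2,
        (forall u, 0 < u < t -> ~ KS n (z.1 + u *: z.2)),
        s \in KS_sides n /\ segment s w.1 & w.2 = reflect s z.2].

(* The default value [z] is only used when no point of [KS n] is hit; the
   choice of a side only matters when a vertex is hit. *)
Definition billiard_map n z : state R := xget z (billiard_step n z).

Definition orbit_point n z k : state R := iter k (billiard_map n) z.

Definition orbit n z : set (state R) := range (orbit_point n z).

Definition periodic_orbit n z :=
  (exists2 k, (0 < k)%N & orbit_point n z k = z) /\
  (forall k, ~ KS_vertex n (orbit_point n z k).1).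

(* [y] is a point of [KS n] from which [p] is reached in the direction [th]
   without meeting [KS n] in between. *)
Definition compatible_point n th y p :=
  KS n y /\ exists t : R,
    [/\ 0 <= t, p = y + t *: th &
        forall u, 0 < u < t -> ~ KS n (y + u *: th)].

(* [z0 i] is the initial condition of the [i]th orbit. *)
Definition compatible_sequence (z0 : nat -> state R) :=
  forall n, [/\ inward_state n (z0 n), (z0 n).2 = (z0 0%N).2 &
                compatible_point n (z0 0%N).2 (z0 n).1 (z0 0%N).1].

Definition piecewise_Fagnano n z :=
  [/\ (0 < n)%N, inward_state n z,
      (exists k : int, z.2 = direction (k%:~R * (pi / 3))) &
      exists2 s, s \in KS_sides n.-1 &
        compatible_point n z.2 z.1 (midpoint (ghost s))].

(* A compatible sequence of piecewise Fagnano orbits; [N] is the least index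
   from which all the orbits are piecewise Fagnano. *)
Definition compatible_piecewise_Fagnano (z0 : nat -> state R) (N : nat) :=
  [/\ compatible_sequence z0,
      (forall n, periodic_orbit n (z0 n)),
      base_segment (z0 0%N).1,
      (forall n, (z0 n).2 = direction (pi / 3)) &
      [/\ (1 <= N)%N,
          (forall n, (N <= n)%N -> piecewise_Fagnano n (z0 n)) &
          forall M, (1 <= M)%N ->
            (forall n, (M <= n)%N -> piecewise_Fagnano n (z0 n)) ->
            (N <= M)%N]].

End Billiard.

Section InverseLimit.
Context {R : realType}.
Variable z0 : nat -> state R.
Implicit Types (n m k : nat) (z : state R).

(* The [k >= 1] for which [z] is the [k]th point of the [n]th footprint. *)
Definition footprint_index n z : nat :=
  xget 0%N [set k | [/\ (0 < k)%N, orbit_point n (z0 n) k = z &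
    forall j, (0 < j)%N -> orbit_point n (z0 n) j = z -> (k <= j)%N]].

(* The transition map from level [n.+1] to level [n].  For
   [k = 2 * zeta + beta] with [beta] equal to 1 or 2, [zeta] is [k.-1./2].
   The [k]th preimage of [z] is [z0 n.+1], which truncation of addresses
   (times the identity on directions) sends to [z0 n]. *)
Definition transition n z : state R :=
  let zeta := (footprint_index n.+1 z).-1./2 in
  orbit_point n (z0 n) zeta.+1.

(* The transition map from level [m + d] to level [m]. *)
Fixpoint transition_iter m d z : state R :=
  if d is e.+1 then transition_iter m e (transition (m + e) z) else z.

(* The [j]th factor stands for level [N + j].  Each orbit sits in a discrete
   copy of the set of states, so that finite orbits are discrete factors. *)
Definition footprint (N : nat) :
    set (prod_topology (fun _ : nat => discrete_topology (state R))) :=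
  [set om | (forall j, orbit (N + j) (z0 (N + j)%N) (om j)) /\
    (forall j d, transition_iter (N + j) d (om (j + d)%N) = om j)].

End InverseLimit.

Section PlanarFootprint.
Context {R : realType}.

Definition realized_at (om : nat -> state R) (p : plane R) :=
  (om j).1 @[j --> \oo] --> p.

Definition planar_footprint (z0 : nat -> state R) (N : nat) : set (plane R) :=
  [set p | exists2 om, footprint z0 N om & realized_at om p].

End PlanarFootprint.

Definition cantor_set (T : topologicalType) (A : set T) :=
  [/\ A !=set0, compact A, totally_disconnected A & perfect_set A].

Section SelfSimilar.
Context {R : realType}.
Implicit Types (g : plane R -> plane R) (A B K : set (plane R)).

Definition contractive_similarity g :=
  exists2 r : R, 0 < r < 1 & forall p q, edist (g p) (g q) = r * edist p q.

Definition plane_isometry g := forall p q, edist (g p) (g q) = edist p q.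

Definition IFS_fixed m (phi : 'I_m -> plane R -> plane R) K :=
  [/\ K !=set0, compact K & K = \bigcup_(i in [set: 'I_m]) (phi i @` K)].

Definition attractor K :=
  exists m (phi : 'I_m -> plane R -> plane R),
    [/\ forall i, contractive_similarity (phi i), IFS_fixed phi K &
        forall K', IFS_fixed phi K' -> K' = K].

(* Juxtaposed without overlapping: contact in at most one point. *)
Definition abutting A B := is_subset1 (A `&` B).

Definition self_similar A :=
  attractor A \/
  exists2 K, attractor K &
    exists m (g : 'I_m -> plane R -> plane R),
      [/\ forall i, plane_isometry (g i),
          A = \bigcup_(i in [set: 'I_m]) (g i @` K) &
          forall i j, i != j -> abutting (g i @` K) (g j @` K)].

End SelfSimilar.

(* Main.v *)
Require Import Defs.
From HB Require Import structures.
From mathcomp Require Import all_boot all_order all_algebra.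
From mathcomp Require Import all_classical all_reals all_analysis.
From mathcomp Require Import zify ring lra.

(** In the triangular lattice of mesh 3^-n the polygon KS_n is a union of
    edges. On a line of direction pi/3, the piecewise Fagnano condition at
    level N forces the lattice abscissa of the basepoint to be half-integral
    ([fagnano_half]); it is then half-integral at all later levels, since 3 (i
    + 1/2) = (3 i + 1) + 1/2. Hence, from level N on, an orbit runs through
    lattice triangles from midpoint of edge to midpoint of edge. The
    reflections preserve the set of odd multiples of pi/3, and of the two
    directions in which such an orbit can leave a midpoint exactly one is odd;
    a state of the orbit is thus the same thing as a side of KS_n, oriented
    with the interior on its left.

    Where a ray bounces is decided by which lattice triangles are inside the
    polygon. This set obeys a local recursion ([inside]), and the edges that
    separate it from its complement are exactly the sides of KS_n
    ([mem_side_darts]). From level n to level n + 1, the midpoint of a side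
    becomes the midpoint of a ghost. The old path stays free, because
    triangles that were inside remain inside, but instead of bouncing on the
    side the ray enters the cell, bounces once on each of its two other sides,
    and comes back through the ghost in the direction of the old reflection
    ([hits_second_first], [hits_first_second]). So the orbit of level n + 1
    meets, at the times 2 k + 1 and 2 k + 2, the two cell sides erected on the
    side met at time k + 1 by the orbit of level n, and the transition map
    sends both to that side. The inverse limit is therefore the set of
    infinite paths in finitely many binary trees ([footprintP]), a finite
    disjoint union of copies of the Cantor space ([cantor_set_bigcup]).

    In the frame of a side, the two cell sides erected on it are its images
    under two fixed similarities of ratio 1/3. A path thus converges to the
    point of the attractor of these two maps with the same binary code,
    carried over by the frame of the initial side ([dart_path_limit]). Over
    each side of KS_n stands a thin isosceles triangle that contains all these
    limits; the triangles of distinct sides share at most end points of sides,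
    which are never limits ([thin_triangle_separation],
    [coded_point_not_end]), so a limit determines its path
    ([coded_point_path]). The planar footprint is then a disjoint union of
    isometric copies of one attractor. *)

Set Implicit Arguments.
Unset Strict Implicit.
Unset Printing Implicit Defensive.
Import Order.TTheory GRing.Theory Num.Theory.
Import numFieldNormedType.Exports.
Local Open Scope classical_set_scope.
Local Open Scope ring_scope.

(** * Darts, faces and the lattice polygons *)

(** The six lattice directions: [Dk] is the angle k pi/3. *)
Inductive dir6 := D0 | D1 | D2 | D3 | D4 | D5.

Definition dir6_code (b : dir6) : nat :=
  match b with D0 => 0 | D1 => 1 | D2 => 2 | D3 => 3 | D4 => 4 | D5 => 5 end.

Lemma dir6_codeK :
  cancel dir6_code (nth D0 [:: D0; D1; D2; D3; D4; D5]).
Proof. by case. Qed.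

HB.instance Definition _ := Choice.copy dir6 (can_type dir6_codeK).

Definition turn_left (b : dir6) : dir6 :=
  match b with D0 => D1 | D1 => D2 | D2 => D3 | D3 => D4 | D4 => D5 | D5 =>
    D0 end.
Definition turn_right (b : dir6) : dir6 :=
  match b with D0 => D5 | D1 => D0 | D2 => D1 | D3 => D2 | D4 => D3 | D5 =>
    D4 end.
Definition opposite (b : dir6) : dir6 := turn_left (turn_left (turn_left b)).
Definition odd_dir (b : dir6) : bool := odd (dir6_code b).

(** Coordinates are taken in the basis of the unit vectors of angles 0 and
    pi/3. *)
Definition lattice_step (b : dir6) : int * int :=
  match b with
  | D0 => (1, 0) | D1 => (0, 1) | D2 => (-1, 1)
  | D3 => (-1, 0) | D4 => (0, -1) | D5 => (1, -1)
  end.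

(** An oriented lattice edge, given by its starting vertex and its direction.
    *)
Definition dart := (int * int * dir6)%type.
(** The upward triangle [(true, i, j)] and the downward triangle [(false, i,
    j)] are the two halves of the lattice parallelogram with lower left vertex
    (i, j). *)
Definition triangle := (bool * int * int)%type.

Definition left_offset (b : dir6) : triangle :=
  match b with
  | D0 => (true, 0, 0) | D2 => (true, -1, 0) | D4 => (true, 0, -1)
  | D1 => (false, -1, 0) | D3 => (false, -1, -1) | D5 => (false, 0, -1)
  end.

Definition left_face (e : dart) : triangle :=
  let o := left_offset e.2 in (o.1.1, e.1.1 + o.1.2, e.1.2 + o.2).

Definition twin (e : dart) : dart :=
  (e.1.1 + (lattice_step e.2).1, e.1.2 + (lattice_step e.2).2, opposite e.2).

(** A ray of odd direction that enters the left face of [e] through the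
    midpoint of [e] leaves it through the midpoint of [advance e], whose left
    face it enters next. *)
Definition advance (e : dart) : dart :=
  if odd_dir e.2 then (e.1, turn_left e.2)
  else let w := lattice_step (turn_left e.2) in
       (e.1.1 + w.1, e.1.2 + w.2, turn_right e.2).

(** The edge by which the ray leaves, now oriented with the face it comes from
    on its left: this is where the ray starts again after a reflection. *)
Definition bounce (e : dart) : dart := twin (advance e).

Definition first_third (e : dart) : dart := (3 * e.1.1, 3 * e.1.2, e.2).
(** The ghost of the side, on the lattice of the next level. *)
Definition ghost_dart (e : dart) : dart :=
  (3 * e.1.1 + (lattice_step e.2).1, 3 * e.1.2 + (lattice_step e.2).2, e.2).
Definition last_third (e : dart) : dart :=
  (3 * e.1.1 + (lattice_step e.2).1 *+ 2,
    3 * e.1.2 + (lattice_step e.2).2 *+ 2, e.2).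
Definition cell_left (e : dart) : dart :=
  (3 * e.1.1 + (lattice_step e.2).1, 3 * e.1.2 + (lattice_step e.2).2,
    turn_right e.2).
Definition cell_right (e : dart) : dart :=
  (3 * e.1.1 + ((lattice_step e.2).1 + (lattice_step (turn_right e.2)).1),
   3 * e.1.2 + ((lattice_step e.2).2 + (lattice_step (turn_right e.2)).2),
     turn_left e.2).

Definition refine_dart (e : dart) : seq dart :=
  [:: first_third e; cell_left e; cell_right e; last_third e].

Fixpoint side_darts (n : nat) : seq dart :=
  if n is m.+1 then flatten (map refine_dart (side_darts m))
  else [:: (0, 0, D0); (1, 0, D2); (0, 1, D4)].

(** A ray that enters the cell erected on [e] through the ghost has an odd
    direction, so the parity of [e] decides which of the two other sides it
    meets first. *)
Definition first_hit (e : dart) :=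
  if odd_dir e.2 then cell_left e else cell_right e.
Definition second_hit (e : dart) :=
  if odd_dir e.2 then cell_right e else cell_left e.

(** A triangle splits into nine, indexed by the ternary digits [r] and [s].
    They inherit the value of the large triangle; the three that lie at the
    middle of one of its edges are cells when the neighbour across that edge
    is inside. *)
Definition subdivide (X : triangle -> bool) (u : bool) (i j : int) (r s : nat)
  :=
  let up := if u then (r + s <= 2)%N else (r + s <= 1)%N in
  X (up, i, j) ||
  match u, r, s with
  | true, 1%N, 0%N => X (false, i, j + -1)
  | true, 0%N, 1%N => X (false, i + -1, j)
  | true, 1%N, 1%N => X (false, i, j)
  | false, 1%N, 1%N => X (true, i, j)
  | false, 2%N, 1%N => X (true, i + 1, j)
  | false, 1%N, 2%N => X (true, i, j + 1)
  | _, _, _ => false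
  end.

Fixpoint inside (n : nat) (t : triangle) : bool :=
  if n is m.+1 then
    subdivide (inside m) t.1.1 (t.1.2 %/ 3)%Z (t.2 %/ 3)%Z
              `|(t.1.2 %% 3)%Z|%N `|(t.2 %% 3)%Z|%N
  else t == (true, 0, 0).

Definition inside_left (n : nat) (e : dart) : bool := inside n (left_face e).
Definition boundary (n : nat) (e : dart) : bool :=
  inside_left n e && ~~ inside_left n (twin e).

(** The digits [k] and [l] may be any closed integers: the values at the small
    triangles around a given large one are then obtained by computation. *)
Lemma inside_subdivide n u i j k l :
  inside n.+1 (u, 3 * i + k, 3 * j + l) =
  subdivide (inside n) u (i + (k %/ 3)%Z) (j + (l %/ 3)%Z)
              `|(k %% 3)%Z|%N `|(l %% 3)%Z|%N.
Proof. by rewrite /= ![3 * _]mulrC !divzMDl // !modzMDl. Qed.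

Arguments inside : simpl never.

Ltac dart_eq := rewrite /=; congr (_, _, _); rewrite /=; lia.

Lemma twinK e : twin (twin e) = e.
Proof. case: e => [[i j] []]; dart_eq. Qed.

Lemma left_face_bounce e : left_face (bounce e) = left_face e.
Proof. case: e => [[i j] []]; dart_eq. Qed.

Lemma advance3_ghost e : advance (advance (advance (ghost_dart e))) =
  ghost_dart (advance e).
Proof. case: e => [[i j] []]; dart_eq. Qed.

Lemma ghost_twin e : ghost_dart (twin e) = twin (ghost_dart e).
Proof. case: e => [[i j] []]; dart_eq. Qed.

Lemma advance_second_hit e : advance (second_hit e) = ghost_dart e.
Proof. case: e => [[i j] []]; dart_eq. Qed.
Lemma bounce_first_hit e : bounce (first_hit e) = second_hit e.
Proof. case: e => [[i j] []]; dart_eq. Qed.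
Lemma bounce_twin_ghost e : bounce (twin (ghost_dart e)) = first_hit e.
Proof. case: e => [[i j] []]; dart_eq. Qed.

Ltac inside_case :=
  rewrite /inside_left /left_face /= -?addrA inside_subdivide; cbv [subdivide];
    rewrite /= ?addr0.
Ltac inside_solve :=
  intros; inside_case; rewrite ?orbF;
  first [ reflexivity
        | congr (inside _ (_, _, _)); lia
        | congr (inside _ (_, _, _) || inside _ (_, _, _)); lia ].

Lemma inside_ghost n e : inside_left n.+1 (ghost_dart e) = inside_left n e ||
  inside_left n (twin e).
Proof. case: e => [[i j] []]; inside_solve. Qed.

Lemma inside_advance_ghost n e : inside_left n.+1 (advance (ghost_dart e)) =
  inside_left n e.
Proof. case: e => [[i j] []]; inside_solve. Qed.

Lemma inside_advance2_ghost n e :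
  inside_left n.+1 (advance (advance (ghost_dart e))) = inside_left n e ||
    inside_left n (advance e).
Proof. case: e => [[i j] []]; inside_solve. Qed.

Lemma inside_twin_cell_left n e : inside_left n.+1 (twin (cell_left e)) =
  inside_left n (twin e).
Proof. case: e => [[i j] []]; inside_solve. Qed.

Lemma inside_twin_cell_right n e : inside_left n.+1 (twin (cell_right e)) =
  inside_left n (twin e).
Proof. case: e => [[i j] []]; inside_solve. Qed.

Lemma inside_first_third n e : inside_left n.+1 (first_third e) =
  inside_left n e.
Proof. case: e => [[i j] []]; inside_solve. Qed.

Lemma inside_twin_first_third n e : inside_left n.+1 (twin (first_third e)) =
  inside_left n (twin e).
Proof. case: e => [[i j] []]; inside_solve. Qed.

Lemma inside_last_third n e : inside_left n.+1 (last_third e) = inside_left n e.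
Proof. case: e => [[i j] []]; inside_solve. Qed.

Lemma inside_twin_last_third n e : inside_left n.+1 (twin (last_third e)) =
  inside_left n (twin e).
Proof. case: e => [[i j] []]; inside_solve. Qed.

Lemma left_face_cell_left e : left_face (cell_left e) =
  left_face (twin (ghost_dart e)).
Proof. case: e => [[i j] []]; dart_eq. Qed.
Lemma left_face_cell_right e : left_face (cell_right e) =
  left_face (twin (ghost_dart e)).
Proof. case: e => [[i j] []]; dart_eq. Qed.

Lemma inside_cell_left n e : inside_left n.+1 (cell_left e) =
  inside_left n (twin e) || inside_left n e.
Proof. by rewrite /inside_left left_face_cell_left -/(inside_left n.+1 _)
  -ghost_twin inside_ghost twinK. Qed.
Lemma inside_cell_right n e : inside_left n.+1 (cell_right e) =
  inside_left n (twin e) || inside_left n e.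
Proof. by rewrite /inside_left left_face_cell_right -/(inside_left n.+1 _)
  -ghost_twin inside_ghost twinK. Qed.

Lemma int_div3 (i : int) : exists I (r : 'I_3), i = 3 * I + (r : nat)%:Z.
Proof.
exists (i %/ 3)%Z.
have h : (`|(i %% 3)%Z| < 3)%N by lia.
by exists (Ordinal h) => /=; lia.
Qed.

(** The cell erected on a side of the polygon is inside, and the small
    triangles beyond its two free edges belong to the same exterior triangle
    without being cells. *)
Lemma boundary_refine n e e' :
  boundary n e -> e' \in refine_dart e -> boundary n.+1 e'.
Proof.
rewrite /boundary => /andP[h1 h2]; rewrite !inE.
case/or4P => /eqP ->;
  rewrite ?inside_first_third ?inside_twin_first_third ?inside_cell_left
  ?inside_twin_cell_left ?inside_cell_right ?inside_twin_cell_right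
    ?inside_last_third ?inside_twin_last_third h1 h2 //.
by rewrite orbT.
by rewrite orbT.
Qed.

Lemma mem_refine_dart e :
  [/\ first_third e \in refine_dart e, cell_left e \in refine_dart e,
    cell_right e \in refine_dart e &
      last_third e \in refine_dart e].
Proof. by split; rewrite !inE eqxx ?orbT. Qed.

(** Evaluates the closed offsets and comparisons produced by
    [inside_subdivide]. *)
Ltac norm_closed :=
  rewrite -?addrA;
  repeat match goal with
  | |- context [?x + ?c] => is_var x;
      let c' := eval vm_compute in (c : int) in
      lazymatch c' with
      | Posz 0 => rewrite [x + c]addr0
      | _ => progress change (x + c) with (x + c')
      end
  | |- context [(?a <= ?b)%N] =>
      let v := eval vm_compute in (a <= b)%N in
      lazymatch v with
      | true => change (a <= b)%N with true
      | false => change (a <= b)%N with false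
      end
  end.

(** These tactics look for the large dart whose refinement contains a given
    small one, among the edges at the vertices of the surrounding
    parallelogram. *)
Ltac try_parent p :=
  first [ rewrite (_ : (_, _, _) = first_third p);
    [by case: (mem_refine_dart p) | by dart_eq]
        | rewrite (_ : (_, _, _) = cell_left p);
          [by case: (mem_refine_dart p) | by dart_eq]
        | rewrite (_ : (_, _, _) = cell_right p);
          [by case: (mem_refine_dart p) | by dart_eq]
        | rewrite (_ : (_, _, _) = last_third p);
          [by case: (mem_refine_dart p) | by dart_eq]
  ].

Ltac give_parent h p :=
  exists p; [rewrite /=; norm_closed;
    solve [assumption | by move: h;
      do 2 (case: (inside _ _); rewrite /= ?orbT ?andbF ?andbT //)] |
        try_parent p].

Ltac search_parent h I J b :=
  first [ give_parent h (I, J, b) | give_parent h (I + 1, J, b)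
        | give_parent h (I, J + 1, b) | give_parent h (I + 1, J + 1, b) ].

(** A small edge that separates inside from outside either is an outer third
    of an edge of the large lattice that does so, or lies within a large
    exterior triangle and bounds a cell; the middle thirds have the same value
    on both sides. The 54 positions of a small edge are checked one by one. *)
Lemma boundary_coarsen n e' : boundary n.+1 e' ->
  exists2 e, boundary n e & e' \in refine_dart e.
Proof.
case: e' => [[i j] b].
have [I [[r hr] /= ->]] := int_div3 i.
have [J [[s hs] /= ->]] := int_div3 j.
rewrite /boundary /inside_left /left_face /twin; case Eb: b;
  cbn [left_offset lattice_step opposite turn_left fst snd];
rewrite -!addrA !inside_subdivide;
case: r hr => [|[|[|//]]] _; case: s hs => [|[|[|//]]] _; cbv [subdivide];
  rewrite /=;
norm_closed; rewrite ?orbF;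
  try by (case: (inside n _); rewrite /= ?orbT ?andbF).
all: match goal with Eb : _ = ?b |- _ =>
  let bl := eval compute in (turn_left b) in
  let br := eval compute in (turn_right b) in
  move=> h; first [search_parent h I J b | search_parent h I J bl |
    search_parent h I J br] end.
Qed.

(** * Rays through the lattice and the doubling of the dynamics *)

(** The list of sides is characterized locally, which makes it possible to
    follow a ray without any form of the Jordan curve theorem. *)
Lemma mem_side_darts n e : (e \in side_darts n) = boundary n e.
Proof.
elim: n e => [|n IH] e.
  case: e => [[i j] b];
    rewrite /boundary /inside_left /left_face /twin /= /inside /side_darts.
  rewrite !inE -!pair_eqE /pair_eq /= -!pair_eqE /pair_eq /=.
  rewrite -!(can_eq dir6_codeK).
  by case: b => /=; lia.
apply/idP/idP => [/flatten_mapP[e' he' he]|].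
  by apply: boundary_refine he; rewrite -IH.
move=> /boundary_coarsen[e' he' he]; apply/flatten_mapP; exists e' => //.
by rewrite IH.
Qed.

Lemma inside_bounded n : exists B : int,
  forall u i j, inside n (u, i, j) -> `|i| <= B /\ `|j| <= B.
Proof.
elim: n => [|n [B hB]].
  by exists 0 => u i j /eqP[_ -> ->].
exists (3 * B + 5) => u i j.
have [I [[r hr] /= ->]] := int_div3 i.
have [J [[s hs] /= ->]] := int_div3 j.
have close : forall u' a b, inside n (u', a, b) -> `|a - I| <= 1 ->
  `|b - J| <= 1 ->
  `|3 * I + r%:Z| <= 3 * B + 5 /\ `|3 * J + s%:Z| <= 3 * B + 5.
  by move=> u' a b /hB; lia.
rewrite inside_subdivide; cbv [subdivide].
case: r hr close => [|[|[|//]]] _ close; case: s hs close =>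
  [|[|[|//]]] _ close;
 case: u => /=; norm_closed; rewrite ?orbF => h;
 by [apply: close h _ _; lia | case/orP: h => h; apply: close h _ _; lia].
Qed.

(** The odd direction in which the orbits leave the midpoint of a side. *)
Definition ray_direction (b : dir6) : dir6 :=
  if odd_dir b then turn_left (turn_left b) else turn_left b.

Lemma advance2 e : advance (advance e) =
  (e.1.1 + (lattice_step (ray_direction e.2)).1 ,
    e.1.2 + (lattice_step (ray_direction e.2)).2, e.2).
Proof. case: e => [[i j] []]; dart_eq. Qed.

Lemma iter_advance2 k e : iter k.*2 advance e =
  (e.1.1 + (lattice_step (ray_direction e.2)).1 *+ k,
    e.1.2 + (lattice_step (ray_direction e.2)).2 *+ k, e.2).
Proof.
elim: k => [|k IH]; first by rewrite /= !addr0; case: e => [[]].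
by rewrite doubleS !iterS IH advance2 /= -!addrA -!mulrSr.
Qed.

(** [e'] is the first side met by the ray that starts at the midpoint of [e]:
    the faces crossed before are inside, the one beyond [e'] is not. *)
Definition hits n e e' := exists m,
  [/\ forall k, (k <= m)%N -> inside_left n (iter k advance e),
  ~~ inside_left n (iter m.+1 advance e) & e' = bounce (iter m advance e)].

(** Two steps translate the dart by a lattice vector, and the polygon is
    bounded. *)
Lemma ray_exits n e : exists m, ~~ inside_left n (iter m advance e).
Proof.
have [B hB] := inside_bounded n.
exists ((`|B| + `|e.1.1| + `|e.1.2| + 3)%N).*2; rewrite iter_advance2.
apply/negP => /hB; case: e => [[i j] b]; case: b => /=; rewrite ?mul0rn; lia.
Qed.

Lemma hits_exists n e : inside_left n e -> exists e', hits n e e'.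
Proof.
move=> he; have h := ray_exits n e.
case: (ex_minnP h) => [[|m]] hm hmin; first by rewrite he in hm.
exists (bounce (iter m advance e)), m; split => // k km.
by apply: contraT => /hmin; rewrite ltnNge km.
Qed.

Lemma hits_boundary n e e' : hits n e e' -> boundary n e'.
Proof.
move=> [m [h1 h2 ->]];
  rewrite /boundary {1}/inside_left left_face_bounce -/(inside_left n _) h1 //.
by rewrite /bounce twinK.
Qed.

Lemma inside_twin_advance n e : inside_left n (twin (advance e)) =
  inside_left n e.
Proof. by rewrite /inside_left -/(bounce e) left_face_bounce. Qed.

Lemma inside_second_hit n e : inside_left n.+1 (second_hit e) =
  inside_left n (twin e) || inside_left n e.
Proof. by rewrite /second_hit; case: ifP;
  rewrite ?inside_cell_left ?inside_cell_right. Qed.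
Lemma inside_first_hit n e : inside_left n.+1 (first_hit e) =
  inside_left n (twin e) || inside_left n e.
Proof. by rewrite /first_hit; case: ifP;
  rewrite ?inside_cell_left ?inside_cell_right. Qed.
Lemma inside_twin_second_hit n e : inside_left n.+1 (twin (second_hit e)) =
  inside_left n (twin e).
Proof. by rewrite /second_hit; case: ifP;
  rewrite ?inside_twin_cell_left ?inside_twin_cell_right. Qed.

(** A lattice triangle crossed along a midline is crossed, on the finer
    lattice, in three small triangles. *)
Lemma iter_advance_ghost q e : iter (3 * q) advance (ghost_dart e) =
  ghost_dart (iter q advance e).
Proof.
elim: q e => // q IH e.
by rewrite mulnS addnC iterD /= advance3_ghost IH -iterSr.
Qed.

Lemma inside_iter_ghost n e q r : (r < 3)%N ->
  inside_left n (iter q advance e) ->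
  inside_left n.+1 (iter (3 * q + r) advance (ghost_dart e)).
Proof.
move=> hr h; rewrite addnC iterD iter_advance_ghost.
by case: r hr => [|[|[|//]]] _ /=;
  rewrite ?inside_ghost ?inside_advance_ghost ?inside_advance2_ghost h.
Qed.

(** Leaving the second cell side, the ray comes back through the ghost,
    follows the path of level [n], which is still inside, goes through the
    ghost of [e'] and meets the first side of the cell erected on [e']. *)
Lemma hits_second_first n e e' : boundary n e -> hits n e e' ->
  hits n.+1 (second_hit e) (first_hit e').
Proof.
move=> /andP[he hre] [m [hin hout ->]].
(* one step back through the ghost, three small triangles for each of the
   [m.+1] faces, and the cell *)
exists (3 * m.+1).+1; split.
- case=> [|k] hk; first by rewrite inside_second_hit he orbT.
  rewrite iterSr advance_second_hit.
  have [hk'|hk'] := ltnP k (3 * m.+1).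
    rewrite (divn_eq k 3) mulnC; apply: inside_iter_ghost;
      first by rewrite ltn_mod.
    by apply: hin; rewrite -ltnS ltn_divLR // mulnC.
  have -> : k = (3 * m.+1)%N by apply/eqP; rewrite eqn_leq hk' -ltnS hk.
  by rewrite iter_advance_ghost inside_ghost /= inside_twin_advance hin // orbT.
- by rewrite iterSr advance_second_hit iterS iter_advance_ghost
  inside_advance_ghost.
- by rewrite iterSr advance_second_hit iter_advance_ghost -bounce_twin_ghost
  -ghost_twin /bounce twinK.
Qed.

(** Within a cell the ray goes from one free side to the other, as on the
    Fagnano orbit of a triangle. *)
Lemma hits_first_second n e : boundary n e ->
  hits n.+1 (first_hit e) (second_hit e).
Proof.
move=> /andP[he hre]; exists 0%N; split; last by rewrite bounce_first_hit.
  by case=> // _; rewrite inside_first_hit he orbT.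
by rewrite /= -[advance _]twinK -/(bounce _) bounce_first_hit
  inside_twin_second_hit.
Qed.

Lemma cell_left_inj : injective cell_left.
Proof. by case=> [[i j] []] [[i' j'] []] // [*]; congr (_, _, _); lia. Qed.
Lemma cell_right_inj : injective cell_right.
Proof. by case=> [[i j] []] [[i' j'] []] // [*]; congr (_, _, _); lia. Qed.

Lemma cell_parent_inj e e' : left_face (cell_left e) =
  left_face (cell_left e') -> e = e'.
Proof.
by case: e => [[i j] []]; case: e' => [[i' j'] []] // [*];
  first [congr (_, _, _); lia | exfalso; lia].
Qed.
Lemma cell_left_neq_right e : cell_left e != cell_right e.
Proof. by case: e => [[i j] []]; apply/eqP => -[]. Qed.

Lemma advance_inj : injective advance.
Proof. by case=> [[i j] []] [[i' j'] []] // [*]; congr (_, _, _); lia. Qed.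

(** The triangles above the base descend from the initial triangle, and a
    descendant of an inside triangle is inside. *)
Lemma inside_base n (i : int) : 0 <= i -> i < 3 ^+ n ->
  inside_left n (i, 0, D0).
Proof.
elim: n i => [|n IH] i h0 h1.
  by rewrite expr0 in h1; rewrite /inside_left /left_face /= (_ : i = 0) //;
    lia.
have [I [[r hr] /= E]] := int_div3 i; subst i.
have hI : inside_left n (I, 0, D0).
  by apply: IH; [lia | rewrite exprS in h1; move: h1; set X := 3 ^+ n; lia].
move: hI; rewrite /inside_left /left_face /= !addr0 => hI.
have -> : (true, 3 * I + r%:Z, 0) = (true, 3 * I + r%:Z, 3 * 0 + 0) :> triangle.
  by rewrite mulr0 addr0.
rewrite inside_subdivide; case: r hr {h0 h1} => [|[|[|//]]] _; cbv [subdivide];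
  rewrite /=; norm_closed; rewrite ?addr0 hI //.
Qed.

(** * Cartesian coordinates and the sides of the polygons *)

Section LatticeCoordinates.
Context {R : realType}.
Implicit Types (x y t : R) (e : dart) (b : dir6) (n : nat).

Local Notation s3 := (Num.sqrt 3 : R).

Lemma sqrt3_sq : s3 * s3 = 3.
Proof. by rewrite -expr2 sqr_sqrtr. Qed.
Lemma sqrt3_gt0 : 0 < s3. Proof. by rewrite sqrtr_gt0. Qed.

Definition step_x b : R :=
  match b with D0 | D5 => 1 | D1 | D4 => 0 | D2 | D3 => -1 end.
Definition step_y b : R :=
  match b with D1 | D2 => 1 | D0 | D3 => 0 | D4 | D5 => -1 end.

Lemma step_xE b : (lattice_step b).1%:~R = step_x b.
Proof. by case: b; rewrite /= ?rmorphN1. Qed.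
Lemma step_yE b : (lattice_step b).2%:~R = step_y b.
Proof. by case: b; rewrite /= ?rmorphN1. Qed.

Definition lattice_point n x y : plane R :=
  (3 ^- n * (x + y / 2), 3 ^- n * (s3 / 2 * y)).

Definition dart_side n e : side R :=
  (lattice_point n e.1.1%:~R e.1.2%:~R,
   lattice_point n (e.1.1%:~R + step_x e.2) (e.1.2%:~R + step_y e.2)).

Definition dart_midpoint n e : plane R :=
  lattice_point n (e.1.1%:~R + step_x e.2 / 2) (e.1.2%:~R + step_y e.2 / 2).

Definition unit_vector b : plane R :=
  (step_x b + step_y b / 2, s3 / 2 * step_y b).

(** The state of an orbit that has just bounced on the side [e]. *)
Definition phase_state n e : state R :=
  (dart_midpoint n e, unit_vector (ray_direction e.2)).

Lemma scale_gt0 n : 0 < 3 ^- n :> R.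
Proof. by rewrite invr_gt0 exprn_gt0. Qed.

Lemma scaleS n : 3 ^- n.+1 = 3 ^- n / 3 :> R.
Proof. by rewrite exprS invfM mulrC. Qed.

Lemma lattice_point_inj n x y x' y' : lattice_point n x y =
  lattice_point n x' y' -> x = x' /\ y = y'.
Proof.
have h0 := lt0r_neq0 (scale_gt0 n); have h1 := lt0r_neq0 sqrt3_gt0.
move=> [/(mulfI h0) h2 /(mulfI h0)].
have h3 : s3 / 2 != 0 by rewrite mulf_neq0 // invr_neq0.
by move=> /(mulfI h3) h4; split=> //; move: h2; rewrite h4 => /addIr.
Qed.

Lemma planeP (p q : plane R) : p.1 = q.1 -> p.2 = q.2 -> p = q.
Proof. by case: p q => [? ?] [? ?] /= -> ->. Qed.

Lemma refine_dart_sideE n e :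
  refine_side (dart_side n e) = map (dart_side n.+1) (refine_dart e).
Proof.
case: e => [[i j] b]; rewrite /refine_side /cell_apex /ghost /side_vector.
rewrite /dart_side /refine_dart /rotate_cw60 /= /lattice_point scaleS.
have hs := sqrt3_sq; set q := 3 ^- n; set s := Num.sqrt 3 in hs *.
(* Linear arithmetic treats monomials as atoms: the squares of sqrt 3 are
   reduced beforehand. *)
have hq : s * s * q = 3 * q by rewrite hs.
have hx : s * s * q * i%:~R = 3 * q * i%:~R by rewrite hs.
have hy : s * s * q * j%:~R = 3 * q * j%:~R by rewrite hs.
case: b; rewrite /= ?intrD ?intrM ?rmorphMn ?rmorphN /= ?rmorphN1 ?rmorph1
  ?rmorph0.
all: congr [:: (_, _); (_, _); (_, _); (_, _)]; apply: planeP => /=;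
  rewrite /GRing.scale /=; lra.
Qed.

Lemma KS_sidesE n : KS_sides n = map (dart_side n) (side_darts n).
Proof.
elim: n => [|n IH].
  rewrite /= /triangle_sides /dart_side /lattice_point /= expr0.
  by congr [:: (_, _); (_, _); (_, _)]; apply: planeP => /=; lra.
rewrite /= IH -map_comp map_flatten -map_comp; congr flatten.
by apply: eq_map => e /=; rewrite refine_dart_sideE.
Qed.

Lemma segmentP n e x y : segment (dart_side n e) (lattice_point n x y) <->
  exists2 t, 0 <= t <= 1 &
    x = e.1.1%:~R + t * step_x e.2 /\ y = e.1.2%:~R + t * step_y e.2.
Proof.
have E t : (dart_side n e).1 + t *: side_vector (dart_side n e) =
  lattice_point n (e.1.1%:~R + t * step_x e.2) (e.1.2%:~R + t * step_y e.2).
  by rewrite /side_vector /dart_side /lattice_point; apply: planeP;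
    rewrite /= /GRing.scale /=; ring.
split=> [[t ht]|[t ht [-> ->]]]; first by rewrite E => /lattice_point_inj;
  exists t.
by exists t.
Qed.

Lemma KSP n x y : KS n (lattice_point n x y) <-> exists e,
  [/\ e \in side_darts n &
  exists2 t, 0 <= t <= 1 &
    x = e.1.1%:~R + t * step_x e.2 /\ y = e.1.2%:~R + t * step_y e.2].
Proof.
rewrite /KS KS_sidesE; split.
  by move=> [s /mapP[e he ->] /segmentP h]; exists e.
by move=> [e [he /segmentP h]]; exists (dart_side n e); first exact: map_f.
Qed.

(** Edges have three directions, and along each of them one of the two
    coordinates or their sum is a constant integer. *)
Lemma KS_integral n x y : KS n (lattice_point n x y) ->
  exists k : int, [\/ x = k%:~R, y = k%:~R | x + y = k%:~R].
Proof.
move=> /KSP[[[i j] b] [_ [t _ [-> ->]]]].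
case: b => /=; rewrite ?mulr0 ?addr0.
- by exists j; constructor 2.
- by exists i; constructor 1.
- by exists (i + j); constructor 3; rewrite intrD; lra.
- by exists j; constructor 2.
- by exists i; constructor 1.
- by exists (i + j); constructor 3; rewrite intrD; lra.
Qed.

Lemma int_gap (a b : int) x : a%:~R < x < a%:~R + 1 -> x != b%:~R.
Proof.
move=> /andP[h1 h2]; apply/eqP => E; move: h1 h2; rewrite E.
have -> : a%:~R + 1 = (a + 1)%:~R :> R by rewrite intrD.
by rewrite !ltr_int; lia.
Qed.

Lemma lattice_point_off_KS n (i j k : int) x y : i%:~R < x < i%:~R + 1 ->
  j%:~R < y < j%:~R + 1 -> k%:~R < x + y < k%:~R + 1 ->
    ~ KS n (lattice_point n x y).
Proof.
move=> hx hy hxy /KS_integral[m [] E].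
- by move: (int_gap m hx); rewrite E eqxx.
- by move: (int_gap m hy); rewrite E eqxx.
- by move: (int_gap m hxy); rewrite E eqxx.
Qed.

Lemma lattice_point_shift n x y t b :
  lattice_point n x y + (t * 3 ^- n) *: unit_vector b =
    lattice_point n (x + t * step_x b) (y + t * step_y b).
Proof.
by rewrite /lattice_point /unit_vector; apply: planeP;
  rewrite /= /GRing.scale /=; ring.
Qed.

(** Between two consecutive midpoints a ray is interior to a lattice triangle:
    neither coordinate is integral, nor is their sum. *)
Lemma ray_off_KS n e t : 0 < t < 1 ->
  ~ KS n (dart_midpoint n e + (t / 2 * 3 ^- n) *: unit_vector
    (ray_direction e.2)).
Proof.
case: e => [[i j] b] ht; rewrite /dart_midpoint lattice_point_shift.
case: b; rewrite /ray_direction /=;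
 [apply: (@lattice_point_off_KS _ i j (i + j)) | apply:
   (@lattice_point_off_KS _ (i - 1) j (i + j))
 |apply: (@lattice_point_off_KS _ (i - 1) j (i + j - 1)) |apply:
   (@lattice_point_off_KS _ (i - 1) (j - 1) (i + j - 1))
 |apply: (@lattice_point_off_KS _ i (j - 1) (i + j - 1)) |apply:
   (@lattice_point_off_KS _ i (j - 1) (i + j))];
 rewrite ?intrD ?rmorphN ?rmorph1 /=; lra.
Qed.

End LatticeCoordinates.

(** * Midpoints of edges *)

Section EdgeMidpoints.
Context {R : realType}.
Implicit Types (x y t : R) (e : dart) (b : dir6) (n : nat).

Lemma int_close (a b : int) : - (2 : R) < a%:~R - b%:~R < (2 : R) ->
  [\/ a = b, a = b + 1 | b = a + 1].
Proof.
move=> /andP[h1 h2].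
have {}h1 : (-2 : int)%:~R < (a - b)%:~R :> R by rewrite intrB rmorphN.
have {}h2 : (a - b)%:~R < (2 : int)%:~R :> R by rewrite intrB.
move: h1 h2; rewrite !ltr_int => h1 h2.
have [h|[h|h]] : a = b \/ a = b + 1 \/ b = a + 1 by lia.
- by constructor 1.
- by constructor 2.
- by constructor 3.
Qed.

(** A lattice edge is determined by its midpoint, up to orientation. *)
Lemma dart_midpoint_on_side n e e' :
  segment (dart_side n e') (dart_midpoint n e : plane R) ->
  e' = e \/ e' = twin e.
Proof.
move=> /segmentP[t ht []].
case: e e' => [[i j] b] [[i' j'] b'] /= E1 E2.
have [hi hj] : - (2 : R) < i%:~R - i'%:~R < (2 : R) /\
  - (2 : R) < j%:~R - j'%:~R < (2 : R).
  by split; move: E1 E2; case: b; case: b' => /=; lra.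
case: (int_close hi) => Ei; case: (int_close hj) => Ej; subst;
  rewrite ?intrD in E1, E2;
  case: b E1 E2; case: b' => /= E1 E2;
  first [ by exfalso; lra
        | by left; congr (_, _, _); lia
        | by right; rewrite /twin /=; congr (_, _, _); lia ].
Qed.

End EdgeMidpoints.

(** * The billiard map on midpoints *)

Section BilliardSteps.
Context {R : realType}.
Implicit Types (x y t : R) (e : dart) (b : dir6) (n : nat).

Lemma dart_midpoint_in_KS n e : e \in side_darts n ->
  KS n (dart_midpoint n e : plane R).
Proof.
move=> he; apply/KSP; exists e; split=> //; exists (1 / 2); first lra.
by rewrite ![1 / 2 * _]mulrC mul1r.
Qed.

Lemma dart_midpoint_segment n e :
  segment (dart_side n e) (dart_midpoint n e : plane R).
Proof. by apply/segmentP; exists (1 / 2); [lra | split; ring]. Qed.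

Lemma dart_midpoint_KS n e : KS n (dart_midpoint n e : plane R) ->
  (e \in side_darts n) || (twin e \in side_darts n).
Proof.
rewrite /KS KS_sidesE /= => -[s /mapP[e' he' ->] /dart_midpoint_on_side[E|E]].
  by rewrite -E he'.
by rewrite -E he' orbT.
Qed.

(** An edge with both faces inside is not a side. *)
Lemma dart_midpoint_off_KS n e : inside_left n e -> inside_left n (twin e) ->
  ~ KS n (dart_midpoint n e : plane R).
Proof.
by move=> h1 h2 /dart_midpoint_KS;
  rewrite !mem_side_darts /boundary twinK h1 h2.
Qed.

Lemma dart_midpoint_twin n e : dart_midpoint n (twin e) =
  dart_midpoint n e :> plane R.
Proof.
by case: e => [[i j] []]; rewrite /dart_midpoint /twin /=; congr lattice_point;
  rewrite ?intrD ?rmorphN ?rmorph1 /=; lra.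
Qed.

Lemma ray_direction_advance e : ray_direction (advance e).2 = ray_direction e.2.
Proof. by case: e => [[i j] []]. Qed.

Lemma dart_midpoint_advance n e :
  dart_midpoint n (advance e) =
    dart_midpoint n e + (1 / 2 * 3 ^- n) *: unit_vector (ray_direction e.2) :>
      plane R.
Proof.
rewrite /dart_midpoint lattice_point_shift.
by case: e => [[i j] []]; rewrite /ray_direction /=; congr lattice_point;
  rewrite ?intrD ?rmorphN ?rmorph1 /=; lra.
Qed.

Lemma ray_direction_iter k e : ray_direction (iter k advance e).2 =
  ray_direction e.2.
Proof. by elim: k => //= k IH; rewrite ray_direction_advance. Qed.

Lemma dart_midpoint_iter n k e : dart_midpoint n (iter k advance e) =
  dart_midpoint n e + (k%:R / 2 * 3 ^- n) *: unit_vector (ray_direction e.2) :>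
    plane R.
Proof.
elim: k => [|k IH]; first by rewrite /= !mul0r scale0r addr0.
by rewrite iterS dart_midpoint_advance IH ray_direction_iter -addrA -scalerDl
  -natr1; congr (_ + _ *: _); ring.
Qed.

(** The two orientations of an edge have opposite parities, whence different
    rays on its two sides. *)
Lemma ray_direction_opposite b : ray_direction (opposite b) <> ray_direction b.
Proof. by case: b. Qed.

Lemma unit_vector_inj b b' : unit_vector b = unit_vector b' :> plane R -> b =
  b'.
Proof.
have h := @sqrt3_gt0 R.
move=> E; have := congr1 snd E; have := congr1 fst E.
by case: b {E}; case: b' => //= E1 E2; exfalso; lra.
Qed.

Lemma phase_state_inj n : injective (@phase_state R n).
Proof.
move=> e e' E.
have E1 : dart_midpoint n e = dart_midpoint n e' :> plane R := congr1 fst E.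
have /unit_vector_inj E2 : unit_vector (ray_direction e.2) =
  unit_vector (ray_direction e'.2) :> plane R := congr1 snd E.
have := dart_midpoint_segment n e; rewrite {}E1 =>
  /dart_midpoint_on_side[//|E1].
by rewrite E1 in E2; case: (@ray_direction_opposite e'.2 E2).
Qed.

Lemma side_vectorE n e : side_vector (dart_side n e) =
  3 ^- n *: unit_vector e.2 :> plane R.
Proof.
by apply: planeP; rewrite /side_vector /dart_side /lattice_point /unit_vector
  /= /GRing.scale /=; ring.
Qed.

Lemma dot_unit_vector b : dot (unit_vector b) (unit_vector b) = 1 :> R.
Proof.
have hs := @sqrt3_sq R; rewrite /dot /unit_vector /=.
by set s := Num.sqrt 3 in hs *; case: b => /=; lra.
Qed.

Lemma reflect_side n e (v : plane R) : Defs.reflect (dart_side n e) v =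
  (2 * dot v (unit_vector e.2)) *: unit_vector e.2 - v.
Proof.
have hq := lt0r_neq0 (scale_gt0 n : 0 < 3 ^- n :> R).
rewrite /Defs.reflect side_vectorE scalerA; congr (_ *: _ - _).
have E (u w : plane R) (q : R) : dot u (q *: w) = q * dot u w.
  by rewrite /dot /= /GRing.scale /=; ring.
have E' (u w : plane R) (q : R) : dot (q *: u) w = q * dot u w.
  by rewrite /dot /= /GRing.scale /=; ring.
by rewrite !E E' dot_unit_vector; field.
Qed.

(** Both orientations are considered because a side on which the ray bounces
    is only known through its midpoint. *)
Lemma reflect_bounce n e e' : e' = bounce e \/ e' = twin (bounce e) ->
  Defs.reflect (dart_side n e') (unit_vector (ray_direction e.2)) =
    unit_vector (ray_direction (bounce e).2) :> plane R.
Proof.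
have hs := @sqrt3_sq R.
rewrite reflect_side /dot /unit_vector /=; set s := Num.sqrt 3 in hs *.
have hs3 : s * s * s = 3 * s by rewrite hs.
case: e => [[i j] b] [->|->]; case: b;
  by apply: planeP; rewrite /= /GRing.scale /=; lra.
Qed.

Lemma dart_midpoint_bounce n e : dart_midpoint n (bounce e) =
  dart_midpoint n (advance e) :> plane R.
Proof. by rewrite /bounce dart_midpoint_twin. Qed.

(** A point of the ray is located by the last midpoint passed, [k], and the
    fraction [d] of the way to the next one. *)
Lemma ray_points n e (m : nat) (u : R) :
  0 < u < m.+1%:R / 2 * 3 ^- n ->
  exists k d, [/\ (k <= m)%N, 0 <= d < 1, u = (k%:R + d) / 2 * 3 ^- n &
    dart_midpoint n e + u *: unit_vector (ray_direction e.2) =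
    dart_midpoint n (iter k advance e) + (d / 2 * 3 ^- n) *: unit_vector
      (ray_direction (iter k advance e).2)].
Proof.
move=> /andP[u0 u1].
have hq := scale_gt0 n : 0 < 3 ^- n :> R.
set q := 3 ^- n in hq u1 *.
pose v := u / q * 2.
have hv : v / 2 * q = u by rewrite /v; field; rewrite lt0r_neq0.
have v0 : 0 <= v by rewrite /v mulr_ge0 // divr_ge0 // ltW.
have v1 : v < m.+1%:R.
  by rewrite /v -ltr_pdivlMr // ltr_pdivrMr.
exists (Num.trunc v), (v - (Num.trunc v)%:R).
have /andP[t1 t2] := truncn_itv v0.
split.
- by rewrite -ltnS -(ltr_nat R); apply: le_lt_trans v1.
- by rewrite subr_ge0 t1 /= ltrBlDr addrC natr1.
- by rewrite -hv; ring.
rewrite ray_direction_iter dart_midpoint_iter -addrA -scalerDl -/q;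
  congr (_ + _ *: _).
by rewrite -hv; ring.
Qed.

(** The midpoint of the side met is the first point of the polygon on the ray,
    and no other side contains it, so the step of the billiard is forced. *)
Lemma billiard_mapE n e e' : hits n e e' -> e' \in side_darts n ->
  billiard_map n (phase_state n e) = phase_state n e' :> state R.
Proof.
move=> [m [hin hout ->]] hLS.
set t := m.+1%:R / 2 * 3 ^- n : R.
have hq := scale_gt0 n : 0 < 3 ^- n :> R.
have t0 : 0 < t by rewrite /t mulr_gt0 // divr_gt0.
have ht : dart_midpoint n (bounce (iter m advance e)) =
  dart_midpoint n e + t *: unit_vector (ray_direction e.2) :> plane R.
  by rewrite dart_midpoint_bounce -iterS dart_midpoint_iter.
have free u : 0 < u < t ->
  ~ KS n (dart_midpoint n e + u *: unit_vector (ray_direction e.2)).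
  move=> hu; have [k [d [km /andP[d0 d1] Eu ->]]] := ray_points e hu.
  move: d0; rewrite le_eqVlt => /orP[/eqP d0|d0]; last first.
    by apply: ray_off_KS; rewrite d0.
  rewrite -d0 !mul0r scale0r addr0.
  case: k km Eu => [|k] km Eu.
    by move: hu; rewrite Eu -d0 addr0 !mul0r ltxx.
  apply: dart_midpoint_off_KS; first exact: hin.
  by rewrite iterS inside_twin_advance hin // ltnW.
apply: xget_unique.
  exists t, (dart_side n (bounce (iter m advance e))); split => //=.
  - by split; [rewrite KS_sidesE map_f | exact: dart_midpoint_segment].
  - by rewrite -(ray_direction_iter m) (@reflect_bounce n (iter m advance e))
    //; left.
move=> [w1 w2] [t' [s' [t'0 /= E1 hfree [hs' hseg] E2]]].
have KSw : KS n w1 by exists s'.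
have tt' : t' = t.
  apply/eqP; case: (ltgtP t' t) => // h.
    by exfalso; apply: (free t'); rewrite ?t'0 ?h // -E1.
  exfalso; apply: (hfree t); first by rewrite t0 h.
  by rewrite -ht; apply: dart_midpoint_in_KS.
have Ew1 : w1 = dart_midpoint n (bounce (iter m advance e)) by rewrite E1 tt'
  ht.
move: hs'; rewrite KS_sidesE => /mapP[e'' he'' Es'].
rewrite /phase_state Ew1 E2; congr (_, _).
rewrite -(ray_direction_iter m) Es' (@reflect_bounce n (iter m advance e)) //.
by apply: (@dart_midpoint_on_side R n); rewrite -Ew1 -Es'.
Qed.

End BilliardSteps.

(** * The initial conditions *)

Section InitialSide.
Context {R : realType}.
Implicit Types (x y t : R) (e : dart) (b : dir6) (n : nat).
Local Notation s3 := (Num.sqrt 3 : R).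

(** With c = cos (pi/3), the triple angle formula gives (c + 1) (2 c - 1)^2 =
    0. *)
Lemma cos_sin_pi3 : cos (pi / 3 : R) = 1 / 2 /\ sin (pi / 3) = s3 / 2.
Proof.
have p0 := @pi_gt0 R.
have hc : 0 < cos (pi / 3 : R).
  by apply: cos_gt0_pihalf; apply/andP; split; lra.
have hs : 0 < sin (pi / 3 : R).
  by apply: sin_gt0_pi; apply/andP; split; lra.
have h1 := cos2Dsin2 (pi / 3 : R).
have h3 : cos (pi / 3 + pi / 3 + pi / 3) = -1 :> R.
  by rewrite -[RHS]cospi; congr cos; field.
move: h3; rewrite !cosD !sinD => h3.
set c := cos _ in hc h1 h3 *; set s := sin _ in hs h1 h3 *.
have Hs : s * s = 1 - c * c by rewrite -h1; ring.
have : (c + 1) * (2 * c - 1) ^+ 2 = 0.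
  have Hss : s * s * c = (1 - c * c) * c by rewrite Hs.
  by move: h3 Hss; rewrite !expr2 => h3 Hss; lra.
move/eqP; rewrite mulf_eq0 sqrf_eq0 => /orP[/eqP h|/eqP h]; first by exfalso;
  lra.
have Ec : c = 1 / 2 by lra.
split=> //; rewrite Ec in Hs.
have s0 := @sqrt3_gt0 R; have ss := @sqrt3_sq R.
have : (s - s3 / 2) * (s + s3 / 2) = 0 by lra.
by move/eqP; rewrite mulf_eq0 => /orP[] /eqP; lra.
Qed.

Lemma direction_pi3 : direction (pi / 3) = unit_vector D1 :> plane R.
Proof.
have [h1 h2] := cos_sin_pi3.
by apply: planeP; rewrite /direction /unit_vector /= ?h1 ?h2 ?mulr1 ?add0r.
Qed.

Lemma lattice_point_shift_up n x y t :
  lattice_point n x y + t *: unit_vector D1 =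
    lattice_point n x (y + t * 3 ^+ n) :> plane R.
Proof.
have h : 3 ^+ n != 0 :> R by rewrite expf_neq0.
have -> : t = t * 3 ^+ n * 3 ^- n by rewrite mulfK.
by rewrite lattice_point_shift /= mulr0 addr0 mulr1 mulfVK.
Qed.

Lemma lattice_point_surj n (p : plane R) : exists x y, p = lattice_point n x y.
Proof.
have h : 3 ^+ n != 0 :> R by rewrite expf_neq0.
have h' := lt0r_neq0 (@sqrt3_gt0 R).
exists (3 ^+ n * (p.1 - p.2 / s3)), (3 ^+ n * (2 * p.2 / s3)).
by apply: planeP; rewrite /lattice_point /=; field; rewrite ?h ?h'.
Qed.

(** These are the sides that a ray of direction pi/3 can leave inwards. *)
Lemma inward_darts n e :
  0 < cross (side_vector (dart_side n e)) (unit_vector D1 : plane R) ->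
  e.2 = D0 \/ e.2 = D5.
Proof.
have hq := scale_gt0 n : 0 < 3 ^- n :> R; have hs := @sqrt3_gt0 R.
have -> : cross (side_vector (dart_side n e)) (unit_vector D1 : plane R) =
  3 ^- n * cross (unit_vector e.2) (unit_vector D1).
  by rewrite side_vectorE /cross /= /GRing.scale /=; ring.
rewrite pmulr_rgt0 // /cross /unit_vector /=.
set s := Num.sqrt 3 in hs *.
by case: e.2 => /= h;
  [left|exfalso; lra|exfalso; lra|exfalso; lra|exfalso; lra|right].
Qed.

(** Such a side spans exactly one unit of abscissa, so a half-integral
    abscissa is that of its midpoint. *)
Lemma inward_half n (z : state R) (I : int) y :
  z.2 = unit_vector D1 -> inward_state n z -> z.1 =
    lattice_point n (I%:~R + 1 / 2) y ->
  exists e, [/\ e \in side_darts n, e.1.1 = I, e.2 = D0 \/ e.2 = D5 & z =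
    phase_state n e].
Proof.
case: z => [z1 z2] /= -> [_ [s [hs hseg hc]]] E.
move: hs hseg hc; rewrite KS_sidesE => /mapP[e he ->] /= hseg hc.
have hb := inward_darts hc.
move: hseg; rewrite E => /segmentP[t ht [E1 E2]].
case: e he hb E1 E2 {hc} => [[i j] b] /= he hb E1 E2.
have vx : step_x b = 1 :> R by case: hb => ->.
rewrite vx mulr1 in E1.
have ii : i = I.
  have h : - (2 : R) < i%:~R - I%:~R < (2 : R) by lra.
  by case: (int_close h) => // EI; exfalso; subst; rewrite intrD in E1; lra.
have tt : t = 1 / 2 by subst i; lra.
exists (i, j, b); split=> //; rewrite /phase_state /dart_midpoint /=;
  congr (_, _).
- by rewrite vx E2 tt ii; congr lattice_point; ring.
- by case: hb => ->.
Qed.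

Lemma ghost_midpoint n e : midpoint (ghost (dart_side n e)) =
  dart_midpoint n.+1 (ghost_dart e) :> plane R.
Proof.
rewrite /midpoint /ghost /side_vector /dart_side /dart_midpoint /ghost_dart
  /lattice_point scaleS /=.
by apply: planeP; rewrite /= /GRing.scale /= !intrD !intrM ?step_xE ?step_yE
  /=; field.
Qed.

(** The abscissa is constant along the direction pi/3. The midpoint of the
    ghost has a half-integral one unless the ghost itself has that direction;
    then the abscissa is integral and the basepoint is a vertex. *)
Lemma fagnano_half n (z : state R) x y :
  z.2 = unit_vector D1 -> z.1 = lattice_point n x y -> ~ KS_vertex n z.1 ->
  piecewise_Fagnano n z -> exists I : int, x = I%:~R + 1 / 2.
Proof.
case: z => [z1 z2] /= -> ->
  nv [n0 [_ [s [hs hseg hc]]] _ [s' hs' /= [_ [t [_ Et _]]]]].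
move: n0 hs' => /=; case: n nv hs hseg hc Et => // n nv hs hseg hc Et _ /=.
rewrite KS_sidesE => /mapP[e' he' Es']; move: Et.
rewrite Es' ghost_midpoint lattice_point_shift_up => /lattice_point_inj[Ex _].
move: hs hseg hc; rewrite KS_sidesE => /mapP[e he Es]; rewrite {}Es => hseg hc.
have hb := inward_darts hc.
move: (hseg) => /segmentP[u hu [E1 E2]].
move: Ex; case: (ghost_dart e') => [[i j] b] /= Ex.
have [vb|vb] : step_x b = 0 :> R \/ (step_x b = 1 :> R \/ step_x b = -1 :> R).
- by case: b Ex => /= _; auto.
- rewrite vb mul0r addr0 in Ex.
  exfalso; apply: nv; exists (dart_side n.+1 e);
    first by rewrite KS_sidesE map_f.
  have vx : step_x e.2 = 1 :> R by case: hb => ->.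
  rewrite vx mulr1 in E1.
  have h : - (2 : R) < i%:~R - e.1.1%:~R < (2 : R) by lra.
  have [u0|u1] : u = 0 \/ u = 1.
    case: (int_close h) => EI.
    + by left; rewrite -EI in E1; lra.
    + by right; rewrite EI intrD in Ex; lra.
    + by exfalso; rewrite EI intrD mulr1z in E1; clear -Ex E1 hu; lra.
  + by left; rewrite /dart_side /= E1 E2 u0 !mul0r !addr0.
  + by right; rewrite /dart_side /= E1 E2 u1 vx !mul1r.
- case: vb => vb; rewrite vb in Ex.
    by exists i; rewrite -Ex.
  by exists (i - 1); rewrite intrB -Ex; lra.
Qed.

Lemma iter_advance_inj k : injective (iter k advance).
Proof. by elim: k => //= k IH e e' /advance_inj /IH. Qed.

(** If one of the two rays started earlier, it would cross the starting edge
    of the other, whose right face is outside. *)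
Lemma sees_uniq n e e' k k' : boundary n e -> boundary n e' ->
  iter k advance e = iter k' advance e' ->
  (forall l, (l <= k)%N -> inside_left n (iter l advance e)) ->
  (forall l, (l <= k')%N -> inside_left n (iter l advance e')) -> e = e'.
Proof.
wlog: e e' k k' / (k <= k')%N => [wl|kk'] be be' E h h'.
  have [kk'|/ltnW kk'] := leqP k k'; first exact: (wl e e' k k').
  by apply/esym/(wl e' e k' k).
move: E; rewrite -(subnKC kk') iterD => /iter_advance_inj E.
case D : (k' - k)%N E => [//|d] E.
move: be => /andP[_]; rewrite E iterS inside_twin_advance h' //.
by lia.
Qed.

(** The ray from [e] reaches the side of abscissa [i] of the base, which
    contains the initial point of level 0, through faces that are all inside.
    *)
Definition sees_base n (i : int) e := exists2 k, iter k advance e = (i, 0, D0) &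
  forall l, (l <= k)%N -> inside_left n (iter l advance e).

(** Seen from the cell side that its ray meets last, the path to the base is
    the path of the previous level with one more small triangle, the cell. *)
Lemma sees_base_second_hit n i e : sees_base n i e ->
  sees_base n.+1 (3 * i + 1) (second_hit e).
Proof.
move=> [k Ek h]; exists (3 * k).+1.
  by rewrite iterSr advance_second_hit iter_advance_ghost Ek /ghost_dart /=
    mulr0 addr0.
case=> [|l] hl; first by rewrite inside_second_hit (h 0%N) ?orbT.
rewrite iterSr advance_second_hit (divn_eq l 3) mulnC; apply: inside_iter_ghost.
  by rewrite ltn_mod.
by apply: h; lia.
Qed.

(** Going up in direction pi/3 from a point below the base, one meets the
    base. *)
Lemma base_path e : e.2 = D0 \/ e.2 = D5 -> e.1.2 <= 0 ->
  exists k, iter k advance e = (e.1.1, 0, D0).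
Proof.
case: e => [[i j] b] /= hb j0.
have hD : exists k, iter k advance (i, j, D0) = (i, 0, D0).
  by exists (`|j|%N).*2; rewrite iter_advance2 /= mul0rn addr0;
    congr (_, _, _); lia.
case: hb => ->; first by [].
by have [k hk] := hD; exists k.+1; rewrite iterSr.
Qed.

(** No point of the polygon lies between the basepoint and the initial point
    of level 0, so by induction along the ray no side is crossed and all faces
    are inside. *)
Lemma compatible_sees_base n (z : state R) (I : int) (p : plane R) :
  z.2 = unit_vector D1 -> inward_state n z -> 0 <= I -> I < 3 ^+ n ->
  p = dart_midpoint n (I, 0, D0) -> compatible_point n z.2 z.1 p ->
  exists e, [/\ boundary n e, sees_base n I e & z = phase_state n e].
Proof.
move=> z2 zin I0 I1 Ep [_ [t [t0 Et free]]].
have Ep' : p = lattice_point n (I%:~R + 1 / 2) 0 by rewrite Ep /dart_midpoint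
  /= mul0r addr0.
have Ez : z.1 = lattice_point n (I%:~R + 1 / 2) (- (t * 3 ^+ n)).
  have [x [y Exy]] := lattice_point_surj n z.1.
  move: Et; rewrite Ep' z2 Exy lattice_point_shift_up =>
    /lattice_point_inj[-> Ey]; congr lattice_point.
  by apply/eqP; rewrite -addr_eq0 -Ey.
have [e [he ei hb Ee]] := inward_half z2 zin Ez.
have j0 : e.1.2 <= 0.
  have q0 : 0 <= t * 3 ^+ n by rewrite mulr_ge0 // exprn_ge0.
  move: Ez; rewrite Ee /= => /lattice_point_inj[_].
  have : step_y e.2 = 0 :> R \/ step_y e.2 = -1 :> R by case: hb => ->; auto.
  move=> hv E.
  suff : e.1.2%:~R < (1 : int)%:~R :> R by rewrite ltr_int; lia.
  by case: hv E => -> E; lra.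
have [k hk] := base_path hb j0; rewrite ei in hk.
exists e; split=> //; first by rewrite -mem_side_darts.
exists k => // l; rewrite leq_eqVlt => /orP[/eqP ->|lk].
  by rewrite hk inside_base.
have {}Et : t = k%:R / 2 * 3 ^- n.
  have := @dart_midpoint_iter R n k e; have -> :
    dart_midpoint n (iter k advance e) = p by rewrite hk Ep.
  rewrite Et Ee /=.
  have ob : ray_direction e.2 = D1 by case: hb => ->.
  rewrite ob => /addrI E.
  have := congr1 snd E; rewrite /unit_vector /= /GRing.scale /= !mulr1.
  by apply: mulIf; rewrite mulf_neq0 ?invr_neq0 // lt0r_neq0 ?sqrt3_gt0.
elim: l lk => [|l IH] lk.
  by move: he; rewrite mem_side_darts => /andP[].
apply: contraT => hn.
exfalso; apply: (free (l.+1%:R / 2 * 3 ^- n)).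
  rewrite Et !mulr_gt0 ?invr_gt0 ?ltr0n ?exprn_gt0 //=.
  by rewrite ltr_pM2r ?scale_gt0 // ltr_pM2r // ltr_nat.
have ob : z.2 = unit_vector (ray_direction e.2) by rewrite z2; case: hb => ->.
rewrite ob Ee /= -dart_midpoint_iter -dart_midpoint_twin;
  apply: dart_midpoint_in_KS.
rewrite mem_side_darts /boundary twinK hn andbT iterS inside_twin_advance IH //.
exact: ltnW.
Qed.

(** The initial side of each level is the only one that sees the base, and by
    [sees_base_second_hit] the second cell side over the previous initial side
    sees it. *)
Lemma initial_darts (z0 : nat -> state R) N :
  compatible_piecewise_Fagnano z0 N ->
  exists2 e, boundary N e & forall j, z0 (N + j)%N =
    phase_state (N + j) (iter j second_hit e).
Proof.
move=> [hc hp [ha1 ha2] hd [N1 hF _]].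
have hd' n : (z0 n).2 = unit_vector D1 by rewrite hd direction_pi3.
set a := (z0 0%N).1.1 in ha1.
have Ea n : (z0 0%N).1 = lattice_point n (3 ^+ n * a) 0.
  have h : 3 ^+ n != 0 :> R by rewrite expf_neq0.
  by apply: planeP; rewrite /lattice_point /= ?ha2 ?mul0r ?mulr0 ?addr0 ?mulKf.
have hy n : exists y, (z0 n).1 = lattice_point n (3 ^+ n * a) y.
  have [x [y Exy]] := lattice_point_surj n (z0 n).1; exists y.
  have [_ _ [_ [t [_ Et _]]]] := hc n.
  by move: Et; rewrite Exy hd' lattice_point_shift_up (Ea n) =>
    /lattice_point_inj[->].
have [I0 hI0] : exists I : int, 3 ^+ N * a = I%:~R + 1 / 2.
  have [y Ey] := hy N.
  exact: (fagnano_half (hd' N) Ey ((hp N).2 0%N) (hF N (leqnn N))).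
pose I j := iter j (fun i : int => 3 * i + 1) I0.
have hI j : 3 ^+ (N + j) * a = (I j)%:~R + 1 / 2.
  elim: j => [|j IH]; first by rewrite addn0.
  by rewrite addnS exprS -mulrA IH /I iterS -/(I j) intrD intrM /=; lra.
have Ib j : 0 <= I j /\ I j < 3 ^+ (N + j).
  have q0 : 0 < 3 ^+ (N + j) :> R by rewrite exprn_gt0.
  move: ha1 => /andP[a0 a1].
  have h0 : 0 <= 3 ^+ (N + j) * a by rewrite mulr_ge0 // ltW.
  have h1 : 3 ^+ (N + j) * a <= 3 ^+ (N + j) by rewrite ler_piMr // ltW.
  rewrite hI in h0 h1; split.
    suff : (-1 : int)%:~R < (I j)%:~R :> R by rewrite ltr_int; lia.
    by rewrite rmorphN1; lra.
  suff : (I j)%:~R < (3 ^+ (N + j))%:~R :> R by rewrite ltr_int.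
  by rewrite rmorphXn /=; lra.
have sb j : exists e, [/\ boundary (N + j) e, sees_base (N + j) (I j) e &
    z0 (N + j)%N = phase_state (N + j) e].
  have [h1 _ h3] := hc (N + j)%N; have [i0 i1] := Ib j.
  apply: (compatible_sees_base (hd' _) h1 i0 i1 _ _).
    2: by rewrite hd -(hd 0%N); exact: h3.
  by rewrite (Ea (N + j)%N) hI /dart_midpoint /= mul0r addr0.
have [e [be se Ee]] := sb 0%N; rewrite addn0 in be se Ee.
exists e => // j.
have {sb} : forall j, z0 (N + j)%N =
  phase_state (N + j) (iter j second_hit e) /\
    (boundary (N + j) (iter j second_hit e) /\
      sees_base (N + j) (I j) (iter j second_hit e)).
  elim=> [|k [IH1 [IH2 IH3]]]; first by rewrite addn0.
  have IH3' := sees_base_second_hit IH3; rewrite addnS iterS.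
  have IH2' : boundary (N + k).+1 (second_hit (iter k second_hit e)).
    by apply: hits_boundary; apply: hits_first_second.
  have [e' [be' [k1 k2 k3] Ee']] := sb k.+1; rewrite addnS in be' k3 Ee'.
  have [l1 l2 l3] := IH3'.
  suff -> : second_hit (iter k second_hit e) = e' by rewrite Ee'; split=> //;
    split=> //; exists k1.
  by apply: (sees_uniq IH2' be' _ l3 k3); rewrite l2 k2.
by move=> /(_ j)[].
Qed.

End InitialSide.

(** * The footprint as a set of tree paths *)

Section OrbitsOfSides.
Context {R : realType}.
Implicit Types (x y t : R) (e : dart) (b : dir6) (n : nat).

Lemma hits_uniq n e e1 e2 : hits n e e1 -> hits n e e2 -> e1 = e2.
Proof.
move=> [m1 [i1 o1 ->]] [m2 [i2 o2 ->]].
suff -> : m1 = m2 by [].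
case: (ltngtP m1 m2) => // h.
- by rewrite i2 in o1.
- by rewrite i1 in o2.
Qed.

(** The default value is never used on a boundary dart. *)
Definition next_side n e : dart := xget e [set e' | hits n e e'].

Lemma next_sideP n e : boundary n e -> hits n e (next_side n e).
Proof.
move=> /andP[/hits_exists[e' h] _]; rewrite /next_side.
by case: xgetP => [e'' -> //|/(_ e')].
Qed.

Lemma next_side_hits n e e' : hits n e e' -> next_side n e = e'.
Proof.
move=> h; apply: (hits_uniq _ h); rewrite /next_side.
by case: xgetP => [e'' -> //|/(_ e')].
Qed.

Definition side_orbit n e k : dart := iter k (next_side n) e.

Lemma boundary_next_side n e : boundary n e -> boundary n (next_side n e).
Proof. by move=> /next_sideP /hits_boundary. Qed.

Lemma boundary_orbit n e k : boundary n e -> boundary n (side_orbit n e k).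
Proof. by move=> he; elim: k => // k; exact: boundary_next_side. Qed.

Lemma orbit_pointE n e k : boundary n e ->
  orbit_point n (phase_state n e) k =
    phase_state n (side_orbit n e k) :> state R.
Proof.
move=> he; elim: k => // k IH;
  rewrite /orbit_point iterS -/(orbit_point n _ k) IH.
have hk := boundary_orbit k he.
rewrite (billiard_mapE (next_sideP hk)) ?mem_side_darts ?boundary_next_side //.
Qed.

Lemma boundary_second_hit n e : boundary n e -> boundary n.+1 (second_hit e).
Proof. by move=> he; apply: hits_boundary; apply: hits_first_second. Qed.

Lemma next_side_second_hit n e : boundary n e ->
  next_side n.+1 (second_hit e) = first_hit (next_side n e).
Proof. by move=> he; apply/next_side_hits/hits_second_first/next_sideP. Qed.

Lemma next_side_first_hit n e : boundary n e -> next_side n.+1 (first_hit e) =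
  second_hit e.
Proof. by move=> he; apply/next_side_hits/hits_first_second. Qed.

(** The doubling of the dynamics, iterated: at even times the orbit of the
    finer level is on a second cell side, at odd times on a first one. *)
Lemma side_orbit_even n e k : boundary n e ->
  side_orbit n.+1 (second_hit e) k.*2 = second_hit (side_orbit n e k).
Proof.
move=> he; elim: k => // k IH; rewrite doubleS /side_orbit !iterS.
have hk := boundary_orbit k he.
by rewrite -/(side_orbit _ _ _) IH next_side_second_hit // next_side_first_hit
  // boundary_next_side.
Qed.

Lemma side_orbit_odd n e k : boundary n e ->
  side_orbit n.+1 (second_hit e) k.*2.+1 = first_hit (side_orbit n e k.+1).
Proof.
move=> he; rewrite /side_orbit iterS -/(side_orbit _ _ _) side_orbit_even //.
by rewrite next_side_second_hit // boundary_orbit.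
Qed.

Lemma cell_left_neq e e' : cell_left e != cell_right e'.
Proof.
apply/eqP => E; have : e = e' by apply: cell_parent_inj;
  rewrite E left_face_cell_right left_face_cell_left.
by move=> ee; move: (cell_left_neq_right e); rewrite E ee eqxx.
Qed.

Lemma first_hit_neq_second e e' : first_hit e != second_hit e'.
Proof.
apply/eqP; rewrite /first_hit /second_hit; case: ifP => o1; case: ifP => o2 E.
- by move: (cell_left_neq e e'); rewrite E eqxx.
- by move: o1 o2; rewrite (cell_left_inj E) => ->.
- by move: o1 o2; rewrite (cell_right_inj E) => ->.
- by move: (cell_left_neq e' e); rewrite E eqxx.
Qed.

Lemma first_hit_inj : injective first_hit.
Proof.
move=> e e'; rewrite /first_hit; case: ifP => o1; case: ifP => o2 E.
- exact: cell_left_inj.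
- by move: (cell_left_neq e e'); rewrite E eqxx.
- by move: (cell_left_neq e' e); rewrite E eqxx.
- exact: cell_right_inj.
Qed.

Lemma second_hit_inj : injective second_hit.
Proof.
move=> e e'; rewrite /second_hit; case: ifP => o1; case: ifP => o2 E.
- exact: cell_right_inj.
- by move: (cell_left_neq e' e); rewrite E eqxx.
- by move: (cell_left_neq e e'); rewrite E eqxx.
- exact: cell_left_inj.
Qed.

(** The choice between left and right does not depend on the parity of [e]. *)
Definition cell_side (left_side : bool) e :=
  if left_side then cell_left e else cell_right e.

Lemma cell_sideE e e' : (exists b : bool, e' = cell_side b e) <-> e' =
  first_hit e \/ e' = second_hit e.
Proof.
rewrite /first_hit /second_hit; case: ifP => _; split.
- by case=> -[->|->]; [left|right].
- by case=> ->; [exists true|exists false].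
- by case=> -[->|->]; [right|left].
- by case=> ->; [exists false|exists true].
Qed.

Fixpoint path_side e (beta : nat -> bool) j : dart :=
  if j is j'.+1 then cell_side (beta j') (path_side e beta j') else e.

Section Footprint.
Variables (z0 : nat -> state R) (N : nat) (e0 : dart) (P : nat).
Hypothesis he0 : boundary N e0.
Hypothesis hz0 : forall j, z0 (N + j)%N =
  phase_state (N + j) (iter j second_hit e0).
Hypothesis P0 : (0 < P)%N.
Hypothesis hP : side_orbit N e0 P = e0.

Let e_ j := iter j second_hit e0.
Let orb j k := side_orbit (N + j) (e_ j) k.

Lemma boundary_init j : boundary (N + j) (e_ j).
Proof.
by elim: j => [|j IH]; rewrite ?addn0 // addnS /e_ iterS;
  apply: boundary_second_hit.
Qed.

Lemma orbit_evens j k : orb j.+1 k.*2 = second_hit (orb j k).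
Proof. by rewrite /orb addnS side_orbit_even //; apply: boundary_init. Qed.

Lemma orbit_odds j k : orb j.+1 k.*2.+1 = first_hit (orb j k.+1).
Proof. by rewrite /orb addnS side_orbit_odd //; apply: boundary_init. Qed.

Lemma orbit_period j : exists2 Q, (0 < Q)%N & forall k, orb j (k + Q) = orb j k.
Proof.
suff [Q Q0 hQ] : exists2 Q, (0 < Q)%N & orb j Q = orb j 0.
  by exists Q => // k; rewrite /orb /side_orbit iterD; congr iter.
elim: j => [|j [Q Q0 hQ]]; first by exists P; rewrite // /orb addn0.
by exists Q.*2; rewrite ?double_gt0 // orbit_evens hQ -[0%N]double0 orbit_evens.
Qed.

Definition on_orbit j e := exists k, e = orb j k.

(** At time 0 the finer orbit starts on a second side; the first side over the
    initial one is met at the end of a period. *)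
Lemma on_orbit_cell j e (b : bool) : on_orbit j e ->
  on_orbit j.+1 (cell_side b e).
Proof.
move=> [k ->]; have : cell_side b (orb j k) =
  first_hit (orb j k) \/ cell_side b (orb j k) = second_hit (orb j k).
  by apply/cell_sideE; exists b.
case=> ->; last by exists k.*2; rewrite orbit_evens.
have [[|Q] // _ hQ] := orbit_period j.
by exists (k + Q).*2.+1; rewrite orbit_odds -addnS hQ.
Qed.

Lemma on_orbit_parent j e : on_orbit j.+1 e ->
  exists2 e', on_orbit j e' & exists b : bool, e = cell_side b e'.
Proof.
move=> [k ->]; rewrite -(odd_double_half k); case: (odd k).
  by exists (orb j k./2.+1);
    [exists k./2.+1 | apply/cell_sideE; left; rewrite orbit_odds].
by exists (orb j k./2);
  [exists k./2 | apply/cell_sideE; right; rewrite orbit_evens].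
Qed.

Lemma orbitE j (z : state R) : Defs.orbit (N + j) (z0 (N + j)%N) z <->
  exists2 e, on_orbit j e & z = phase_state (N + j) e.
Proof.
rewrite hz0; split.
  move=> [k _ <-]; exists (orb j k); first by exists k.
  by rewrite orbit_pointE //; apply: boundary_init.
move=> [e [k ->] ->]; exists k => //.
by rewrite orbit_pointE //; apply: boundary_init.
Qed.

(** By periodicity a point of the orbit is also met at a positive time, so the
    default index 0 does not occur. *)
Lemma footprint_indexP j e : on_orbit j e ->
  let k := footprint_index z0 (N + j) (phase_state (N + j) e) in
  (0 < k)%N /\ orb j k = e.
Proof.
move=> [k0 E]; have [Q Q0 hQ] := orbit_period j.
rewrite /footprint_index; case: xgetP => [k -> [k1 k2 _]|h] /=.
  split=> //; move: k2; rewrite hz0 orbit_pointE; last exact: boundary_init.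
  exact: phase_state_inj.
exfalso.
pose p k := (0 < k)%N && (orb j k == e).
have ex : exists k, p k.
  by exists (k0 + Q)%N; rewrite /p addn_gt0 Q0 orbT hQ E eqxx.
case: (ex_minnP ex) => m /andP[m0 /eqP Em] mmin.
apply: (h m); split=> //; first by rewrite -Em hz0 orbit_pointE //;
  exact: boundary_init.
move=> i i0; rewrite hz0 orbit_pointE; last exact: boundary_init.
by move=> /phase_state_inj Ei; apply: mmin; rewrite /p i0 /orb Ei eqxx.
Qed.

(** First and second sides of cells are never equal, so the parity of any
    index of a cell side is known; half of it is an index of the side below.
    *)
Lemma transition_cell j e (b : bool) : on_orbit j e ->
  transition z0 (N + j) (phase_state (N + j).+1 (cell_side b e)) =
    phase_state (N + j) e.
Proof.
move=> he; rewrite /transition -addnS.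
have [] := footprint_indexP (on_orbit_cell b he).
set k := footprint_index _ _ _ => k0 hk.
rewrite hz0 orbit_pointE; last exact: boundary_init.
congr phase_state; rewrite -/(orb j _).
have : cell_side b e = first_hit e \/ cell_side b e =
  second_hit e by apply/cell_sideE; exists b.
case: k k0 hk => // k _; rewrite [k.+1.-1]/= -{1}(odd_double_half k);
  case: (odd k).
  rewrite add1n -doubleS orbit_evens => <- [E|/second_hit_inj //].
  by move: (first_hit_neq_second e (orb j k./2.+1)); rewrite E eqxx.
rewrite add0n orbit_odds => <- [/first_hit_inj //|E].
by move: (first_hit_neq_second (orb j k./2.+1) e); rewrite E eqxx.
Qed.

(** Only the transitions between consecutive levels matter, and they say that
    each side is one of the two cell sides over the previous one. *)
Lemma footprintP om : footprint z0 N om <->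
  exists2 e, on_orbit 0 e &
    exists beta, forall j, om j = phase_state (N + j) (path_side e beta j).
Proof.
split=> [[h1 h2]|[e he [beta hb]]].
  have [c hc] : {c : nat -> dart & forall j, on_orbit j (c j) /\ om j =
    phase_state (N + j) (c j)}.
    apply: (@choice _ _ (fun j e => on_orbit j e /\ om j =
      phase_state (N + j) e)) => j.
    by have [e ? ?] := (orbitE j (om j)).1 (h1 j); exists e.
  exists (c 0%N); first by case: (hc 0%N).
  have [beta hb] : {beta : nat -> bool & forall j, c j.+1 =
    cell_side (beta j) (c j)}.
    apply: (@choice _ _ (fun j (b : bool) => c j.+1 = cell_side b (c j))) => j.
    have [/on_orbit_parent[e' he' [b Eb]] Ej1] := hc j.+1.
    have [h3 Ej] := hc j.
    exists b; rewrite Eb; congr cell_side.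
    have := h2 j 1%N; rewrite /= addn0 addn1 Ej1 Ej Eb addnS transition_cell //.
    exact: phase_state_inj.
  exists beta => j; rewrite (hc j).2; congr phase_state.
  by elim: j => //= j <-.
have on j : on_orbit j (path_side e beta j).
  by elim: j => // j IH; apply: on_orbit_cell.
split=> j; first by apply/orbitE; exists (path_side e beta j).
elim=> [|d IH]; first by rewrite addn0.
rewrite /= hb !addnS -addnA [path_side _ _ _]/= transition_cell; last exact: on.
by rewrite -hb.
Qed.

End Footprint.

End OrbitsOfSides.

(** * Unions of copies of the Cantor space *)

Lemma cylinder_nbhs (beta : cantor_space) (J : nat) :
  nbhs beta [set gamma : cantor_space | forall i, (i < J)%N -> gamma i =
    beta i].
Proof.
elim: J => [|J IH]; first by apply: filterS (@filterT _ (nbhs beta) _).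
have h : nbhs beta [set gamma : cantor_space | gamma J = beta J].
  apply: (@proj_continuous _ (fun _ : nat => bool) J beta [set beta J]).
  exact: discrete_set1.
apply: filterS (filterI IH h) => gamma [/= h1 h2] i.
by rewrite ltnS leq_eqVlt => /orP[/eqP ->|/h1].
Qed.

(** A neighbourhood in the product restricts finitely many coordinates, and
    each of them is determined by finitely many bits. *)
Lemma discrete_valued_continuous (S : choiceType)
    (F : cantor_space -> prod_topology (fun _ : nat => discrete_topology S)) :
  (forall j (beta gamma : cantor_space),
    (forall i, (i < j)%N -> gamma i = beta i) ->
     F gamma j = F beta j) -> continuous F.
Proof.
move=> hF beta; apply/cvg_sup => j U [V] [[W] oW <-] WfN WU.
apply: filterS (cylinder_nbhs beta j) => gamma /hF E.
by apply: WU; rewrite /= E.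
Qed.

Section CantorUnion.
Variables (T : topologicalType) (m : nat) (f : 'I_m -> cantor_space -> T).
Hypothesis hT : hausdorff_space T.
Hypothesis m0 : (0 < m)%N.
Hypothesis fc : forall i, continuous (f i).
Hypothesis finj : forall i x j y, f i x = f j y -> i = j /\ x = y.

Let image (U : 'I_m -> set cantor_space) : set T :=
  \bigcup_(i in [set: 'I_m]) (f i @` U i).

Lemma image_compact U : (forall i, closed (U i)) -> compact (image U).
Proof.
move=> hU.
have -> : image U = \big[setU/set0]_(i <- enum 'I_m) (f i @` U i).
  rewrite -bigcup_seq; apply: eq_bigcupl; split=> i //= _.
  by rewrite mem_enum.
apply: bigsetU_compact => i _; apply: continuous_compact.
  exact/continuous_subspaceT/fc.
exact: (subclosed_compact (hU i) cantor_space_compact).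
Qed.

Lemma image_closed U : (forall i, closed (U i)) -> closed (image U).
Proof. by move=> /image_compact; apply: compact_closed. Qed.

Lemma image_disjoint U V : (forall i, U i `&` V i = set0) ->
  image U `&` image V = set0.
Proof.
move=> UV; apply/seteqP; split=> // p [[i _ [x Ux <-]] [j _ [y Vy E]]].
have [ji yx] := finj E; subst.
by have : (U i `&` V i) x by []; rewrite UV.
Qed.

(** Two points of the union are separated by the images of a clopen set and of
    its complement, both closed by compactness; perfection is inherited
    through continuity and injectivity. *)
Lemma cantor_set_bigcup : cantor_set (\bigcup_(i in [set: 'I_m]) range (f i)).
Proof.
rewrite -/(image (fun=> setT)).
have clA : closed (image (fun=> setT)) by apply: image_closed => i;
  exact: closedT.
split.
- by exists (f (Ordinal m0) point); exists (Ordinal m0) => //; exists point.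
- by apply: image_compact => i; exact: closedT.
- move=> _ [i _ [x _ <-]]; apply/seteqP; split=> [q|_ ->]; last first.
    by apply: connected_component_refl; exists i => //; exists x.
  move=> [C [Cp CA conC] Cq] /=.
  have [j _ [y _ Eq]] := CA _ Cq; subst q.
  apply: contrapT => ne.
  have [W [cW Wx Wy]] : exists W : set cantor_space,
      [/\ clopen W, W x & (i = j -> ~ W y)].
    have [ij|ij] := eqVneq i j; last first.
      exists setT; split=> //; first by split; [exact: openT|exact: closedT].
      by move=> E; rewrite E eqxx in ij.
    have xy : x != y by apply/eqP => xy; apply: ne; rewrite ij xy.
    by have [W [? ? ?]] := cantor_zero_dimensional xy; exists W.
  pose U k := if k == i then W else set0.
  have cU k : clopen (U k).
    by rewrite /U; case: ifP => // _; split; [exact: open0|exact: closed0].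
  have c1 : closed (image U) by apply: image_closed => k; case: (cU k).
  have c2 : closed (image (fun k => ~` U k)).
    by apply: image_closed => k; rewrite closedC; case: (cU k).
  have dis : image U `&` image (fun k => ~` U k) = set0.
    by apply: image_disjoint => k; rewrite setICr.
  have sep : separated (image U) (image (fun k => ~` U k)).
    by split; rewrite -(closure_id _).1.
  have Up : image U (f i x) by exists i => //; exists x => //; rewrite /U eqxx.
  have Vq : image (fun k => ~` U k) (f j y).
    exists j => //; exists y => //; rewrite /U; case: eqP => [ji|_ []].
    by apply: Wy.
  have CUV : C `<=` image U `|` image (fun k => ~` U k).
    move=> r /CA [k _ [w _ <-]].
    by have [h|h] := pselect (U k w); [left|right]; exists k => //; exists w.
  have [h|h] := connected_subset sep CUV conC.
    by have /seteqP[/(_ (f j y)) d _] := dis; apply: d; split=> //; apply: h.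
  by have /seteqP[/(_ (f i x)) d _] := dis; apply: d; split=> //; apply: h.
- split=> //; apply/seteqP; split=> [p hp|_ [i _ [x _ <-]] V hV].
    by apply: clA => V /hp[q [_ Aq Vq]]; exists q.
  have [_] := cantor_perfect; move/seteqP => [_ /(_ x I)] /(_ (f i @^-1` V)).
  case=> [|y [yx _ Vy]]; first exact: fc.
  exists (f i y); split=> //; last by exists i => //; exists y.
  by apply: contraNneq yx => /finj[_ ->].
Qed.

End CantorUnion.

(** * The two similarities onto the sides of a cell *)

Section CellMaps.
Context {R : realType}.
Implicit Types (x y t : R) (e : dart) (b : dir6) (n : nat).
Local Notation s3 := (Num.sqrt 3 : R).

(** Complex multiplication. *)
Definition cmul (u p : plane R) : plane R :=
  (u.1 * p.1 - u.2 * p.2, u.1 * p.2 + u.2 * p.1).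

(** The similarities that carry the unit segment to the left and right sides
    of the cell erected on it. *)
Definition cell_map (l : bool) (p : plane R) : plane R :=
  (if l then (1 / 3, 0) else (1 / 2, - (s3 / 6))) +
  3^-1 *: cmul (unit_vector (if l then D5 else D1)) p.

(** The direct similarity that carries the unit segment to the side [e]. *)
Definition dart_frame n e (p : plane R) : plane R :=
  lattice_point n e.1.1%:~R e.1.2%:~R + 3 ^- n *: cmul (unit_vector e.2) p.

(** A direct similarity is determined by the image of a segment; here both
    sides carry the unit segment to the same cell side. *)
Lemma dart_frame_cell_map n e (l : bool) p :
  dart_frame n e (cell_map l p) = dart_frame n.+1 (cell_side l e) p.
Proof.
case: e => [[i j] b];
  rewrite /dart_frame /cell_map /cell_side /cell_left /cell_right /cmul
    /lattice_point /unit_vector scaleS /=.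
have hs := @sqrt3_sq R; set q := 3 ^- n; set s := Num.sqrt 3 in hs *.
have hq : s * s * q = 3 * q by rewrite hs.
have hx : s * s * q * p.1 = 3 * q * p.1 by rewrite hs.
have hy : s * s * q * p.2 = 3 * q * p.2 by rewrite hs.
have hx3 : s * s * s * q * p.1 = 3 * s * q * p.1 by rewrite hs.
have hy3 : s * s * s * q * p.2 = 3 * s * q * p.2 by rewrite hs.
have h4 : s * s * s * s = 9 by rewrite hs -mulrA hs; ring.
have hx4 : s * s * s * s * q * p.1 = 9 * q * p.1 by rewrite h4.
have hy4 : s * s * s * s * q * p.2 = 9 * q * p.2 by rewrite h4.
case: l; case: b; apply: planeP;
  rewrite /= /GRing.scale /= ?intrD ?intrM ?rmorphN /= ?rmorph1 ?rmorph0; lra.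
Qed.

Lemma dart_midpoint_frame n e : dart_midpoint n e =
  dart_frame n e (1 / 2, 0) :> plane R.
Proof.
rewrite /dart_midpoint /dart_frame /cmul /lattice_point /unit_vector.
by apply: planeP; rewrite /= /GRing.scale /=; ring.
Qed.

Definition bit_tail (beta : nat -> bool) : nat -> bool := fun i => beta i.+1.

(** The first bit is applied last, that is, it selects the largest cell; this
    is why a path, extended at its end, is compared with [path_side_shift]. *)
Fixpoint ifs_code (beta : nat -> bool) j : plane R :=
  if j is j'.+1 then cell_map (beta 0%N) (ifs_code (bit_tail beta) j') else
    (1 / 2, 0).

Lemma path_side_shift e beta j :
  path_side e beta j.+1 = path_side (cell_side (beta 0%N) e) (bit_tail beta) j.
Proof. by elim: j => //= j ->. Qed.

Lemma dart_midpoint_path n e beta j :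
  dart_midpoint (n + j) (path_side e beta j) =
    dart_frame n e (ifs_code beta j) :> plane R.
Proof.
elim: j n e beta => [|j IH] n e beta;
  first by rewrite addn0 dart_midpoint_frame.
by rewrite path_side_shift addnS -addSn IH /= dart_frame_cell_map.
Qed.

Lemma normE (p : plane R) : `|p| = Num.max `|p.1| `|p.2|.
Proof. by []. Qed.

Lemma norm_leP (p : plane R) c : `|p| <= c <-> `|p.1| <= c /\ `|p.2| <= c.
Proof. by rewrite normE ge_max; split => [/andP|[-> ->]]. Qed.

Lemma sqrt3_lt2 : s3 < 2.
Proof. by have := @sqrt3_sq R; have := @sqrt3_gt0 R; set s := Num.sqrt 3; nra.
  Qed.

(** The norm of the plane is the max norm, for which rotations are not
    isometries; the factor 3/2 still makes the cell maps contractions of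
    factor 1/2. *)
Lemma norm_cmul b (p : plane R) : `|cmul (unit_vector b) p| <= 3 / 2 * `|p|.
Proof.
have h2 := sqrt3_lt2; have h0 := @sqrt3_gt0 R.
have /norm_leP[] := lexx `|p|; set M := `|p|; set s := Num.sqrt 3 in h0 h2 *.
rewrite !ler_norml => /andP[x1 x2] /andP[y1 y2].
apply/norm_leP; rewrite !ler_norml /cmul /unit_vector /= -/s.
by case: b => /=; split; nra.
Qed.

Lemma cell_map_lip (l : bool) (p q : plane R) :
  `|cell_map l p - cell_map l q| <= 2^-1 * `|p - q|.
Proof.
have -> : cell_map l p - cell_map l q =
    3^-1 *: cmul (unit_vector (if l then D5 else D1)) (p - q).
  rewrite /cell_map opprD addrACA subrr add0r -scalerBr; congr (_ *: _).
  by apply: planeP; rewrite /cmul /=; ring.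
rewrite normrZ ger0_norm ?invr_ge0 //.
have := norm_cmul (if l then D5 else D1) (p - q); lra.
Qed.

Lemma cell_map_ball (l : bool) (p : plane R) : `|p| <= 1 ->
  `|cell_map l p| <= 1.
Proof.
move=> hp; have h2 := sqrt3_lt2; have h0 := @sqrt3_gt0 R.
have -> : cell_map l p = (cell_map l p - cell_map l 0) + cell_map l 0.
  by rewrite subrK.
apply: (le_trans (ler_normD _ _)).
have h1 := cell_map_lip l p 0; rewrite subr0 in h1.
suff : `|cell_map l 0| <= 1 / 2 by lra.
apply/norm_leP; rewrite /cell_map /cmul.
set s := Num.sqrt 3 in h0 h2 *.
by case: l {h1} => /=; rewrite /GRing.scale /=; split; rewrite ler_norml;
  apply/andP; split; lra.
Qed.

Lemma ifs_code_ball beta j : `|ifs_code beta j| <= 1.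
Proof.
elim: j beta => [|j IH] beta; last exact: cell_map_ball.
apply/norm_leP => /=; rewrite normr0; split; last by [].
by rewrite ger0_norm; lra.
Qed.

Lemma ifs_code_close beta gamma J j k : (J <= j)%N -> (J <= k)%N ->
  (forall i, (i < J)%N -> gamma i = beta i) ->
  `|ifs_code beta j - ifs_code gamma k| <= 2 * 2^-1 ^+ J.
Proof.
elim: J beta gamma j k => [|J IH] beta gamma j k.
  move=> _ _ _; rewrite expr0 mulr1; apply: (le_trans (ler_normB _ _)).
  by have := ifs_code_ball beta j; have := ifs_code_ball gamma k; lra.
case: j => // j; case: k => // k; rewrite !ltnS => hj hk h /=.
rewrite h //; apply: (le_trans (cell_map_lip _ _ _)).
have {}IH := IH (bit_tail beta) (bit_tail gamma) j k hj hk _.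
rewrite exprS mulrCA ler_pM2l // ; apply: IH => i iJ.
by rewrite /bit_tail h.
Qed.

End CellMaps.

(** * Limits of paths *)

Section CodedPoints.
Context {R : realType}.
Implicit Types (x y t : R) (e : dart) (b : dir6) (n : nat).
Local Notation s3 := (Num.sqrt 3 : R).

Lemma half_expr_small (c eps : R) : 0 < eps -> exists J, c * 2^-1 ^+ J < eps.
Proof.
move=> e0.
have : c * 2^-1 ^+ n @[n --> \oo] --> (0 : R).
  have := @cvg_geometric R c 2^-1; apply; rewrite ger0_norm //; lra.
move/cvgrPdist_lt => /(_ _ e0)[J _ /(_ J (leqnn J))].
rewrite sub0r normrN => h; exists J; exact: le_lt_trans (ler_norm _) h.
Qed.

Lemma cvg_rate (u : nat -> plane R) (p : plane R) (c : R) :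
  (forall j, `|p - u j| <= c * 2^-1 ^+ j) -> u j @[j --> \oo] --> p.
Proof.
move=> h; apply/cvgrPdist_lt => eps e0.
have [J hJ] := half_expr_small c e0.
exists J => // j /= Jj; apply: (le_lt_trans (h j)); apply: le_lt_trans hJ.
have c0 : 0 <= c by have := h 0%N; rewrite expr0 mulr1; apply: le_trans.
apply: ler_wpM2l => //.
apply: ler_wiXn2l => //; lra.
Qed.

(** Completeness is applied to each coordinate of the plane separately. *)
Lemma real_limit (u : nat -> R) (c : R) :
  (forall J j, (J <= j)%N -> `|u J - u j| <= c * 2^-1 ^+ J) ->
  exists a, forall J, `|a - u J| <= c * 2^-1 ^+ J.
Proof.
move=> h.
have : cvg (u @ \oo).
  apply/cauchy_cvgP; apply: cauchy_exP => eps e0.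
  have [J hJ] := half_expr_small c e0.
  exists (u J); exists J => // j /= Jj.
  by rewrite -ball_normE /=; apply: le_lt_trans hJ; exact: h.
move=> /cvg_ex[a /cvgrPdist_le ha]; exists a => J.
rewrite leNgt; apply/negP => hc.
have e0 : 0 < (`|a - u J| - c * 2^-1 ^+ J) / 2 by rewrite divr_gt0 // subr_gt0.
have [K _ hK] := ha _ e0.
have h1 := hK (maxn J K) (leq_maxr _ _).
have h2 := h J (maxn J K) (leq_maxl _ _).
have := ler_normB (a - u (maxn J K)) (u J - u (maxn J K)).
rewrite opprB addrA subrK => h3; move: hc h1 h2 h3; simpl; lra.
Qed.

Lemma ifs_code_cvg beta :
  exists p : plane R, forall j, `|p - ifs_code beta j| <= 2 * 2^-1 ^+ j.
Proof.
have h J j : (J <= j)%N -> `|ifs_code beta J - ifs_code beta j :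
  plane R| <= 2 * 2^-1 ^+ J.
  by move=> Jj; exact: ifs_code_close.
have [a ha] : exists a, forall J,
  `|a - (ifs_code beta J).1| <= 2 * 2^-1 ^+ J :> R.
  by apply: (@real_limit (fun j => (ifs_code beta j).1)) => J j /h /norm_leP[].
have [b hb] : exists b : R, forall J,
  `|b - (ifs_code beta J).2| <= 2 * 2^-1 ^+ J :> R.
  by apply: (@real_limit (fun j => (ifs_code beta j).2)) => J j /h /norm_leP[].
by exists (a, b) => j; apply/norm_leP; split; [exact: ha|exact: hb].
Qed.

Definition coded_point beta : plane R := sval (cid (ifs_code_cvg beta)).

Lemma coded_pointP beta j :
  `|coded_point beta - ifs_code beta j| <= 2 * 2^-1 ^+ j.
Proof. exact: (svalP (cid (ifs_code_cvg beta))). Qed.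

Lemma coded_point_close beta gamma J :
  (forall i, (i < J)%N -> gamma i = beta i) ->
  `|coded_point beta - coded_point gamma| <= 4 * 2^-1 ^+ J.
Proof.
move=> h.
have h1 := coded_pointP beta J; have h2 := coded_pointP gamma J.
have h3 : ifs_code gamma J = ifs_code beta J :> plane R.
  elim: J beta gamma h {h1 h2} => //= J IH beta gamma h.
  by rewrite h // (IH (bit_tail beta)) // => i iJ; rewrite /bit_tail h.
rewrite h3 in h2.
have := ler_normB (coded_point beta - ifs_code beta J)
  (coded_point gamma - ifs_code beta J).
rewrite opprB addrA subrK; lra.
Qed.

Lemma eq_of_close (p q : plane R) (c : R) :
  (forall j, `|p - q| <= c * 2^-1 ^+ j) -> p = q.
Proof.
move=> h; apply/eqP; rewrite -subr_eq0 -normr_le0 leNgt; apply/negP => h0.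
have [J hJ] := half_expr_small c h0.
by have := h J; rewrite leNgt hJ.
Qed.

Lemma coded_point_cons beta : coded_point beta =
  cell_map (beta 0%N) (coded_point (bit_tail beta)).
Proof.
apply: (@eq_of_close _ _ 4) => j.
have h1 := coded_pointP beta j.+1; have h2 := coded_pointP (bit_tail beta) j.
have := cell_map_lip (beta 0%N) (coded_point (bit_tail beta))
  (ifs_code (bit_tail beta) j).
rewrite -/(ifs_code beta j.+1) => h3.
have := ler_normB (coded_point beta - ifs_code beta j.+1)
  (cell_map (beta 0%N) (coded_point (bit_tail beta)) - ifs_code beta j.+1).
rewrite opprB addrA subrK; move: h1 h2 h3; rewrite exprS.
have : 0 <= 2^-1 ^+ j :> R by rewrite exprn_ge0.
set x := 2^-1 ^+ j; simpl; lra.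
Qed.

Lemma dart_frame_lip n e (p q : plane R) :
  `|dart_frame n e p - dart_frame n e q| <= 2 * `|p - q|.
Proof.
have -> : dart_frame n e p - dart_frame n e q =
  3 ^- n *: cmul (unit_vector e.2) (p - q).
  rewrite /dart_frame opprD addrACA subrr add0r -scalerBr; congr (_ *: _).
  by apply: planeP; rewrite /cmul /=; ring.
have h0 := scale_gt0 n : 0 < 3 ^- n :> R.
have h1 : 3 ^- n <= 1 :> R by rewrite invf_le1 ?exprn_gt0 // exprn_ege1 //
  ler1n.
rewrite normrZ (gtr0_norm h0).
have := norm_cmul e.2 (p - q); have :=
  normr_ge0 (cmul (unit_vector e.2) (p - q)); nra.
Qed.

(** The limit of the midpoints along a path of sides is read in the frame of
    the first side. *)
Lemma dart_path_limit n e beta :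
  dart_midpoint (n + j) (path_side e beta j) @[j --> \oo] --> dart_frame n e
    (coded_point beta).
Proof.
apply: (@cvg_rate _ _ 4) => j; rewrite dart_midpoint_path.
apply: (le_trans (dart_frame_lip _ _ _ _)).
by have := coded_pointP beta j; lra.
Qed.

(** The same limit can be read in the frame of any side of the path. *)
Lemma dart_frame_coded_point n e beta J : dart_frame n e (coded_point beta) =
  dart_frame (n + J) (path_side e beta J)
    (coded_point (fun i => beta (J + i)%N)).
Proof.
elim: J n e beta => [|J IH] n e beta; first by rewrite addn0.
by rewrite coded_point_cons dart_frame_cell_map IH path_side_shift addnS -addSn.
Qed.

(** The isosceles triangle on the unit segment whose apex is that of the cell.
    It contains its images under the four maps that refine a side. *)
Definition thin_triangle (p : plane R) :=
  [/\ p.2 <= 0, 0 <= p.1 + s3 * p.2 & p.1 - s3 * p.2 <= 1].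

Lemma thin_triangle_cell_map l p : thin_triangle p ->
  thin_triangle (cell_map l p).
Proof.
have hs := @sqrt3_sq R; have h0 := @sqrt3_gt0 R.
case: p => x y [/= h1 h2 h3];
  rewrite /thin_triangle /cell_map /cmul /unit_vector.
set s := Num.sqrt 3 in hs h0 h2 h3 *.
have hy : s * s * y = 3 * y by rewrite hs.
have hx : s * s * x = 3 * x by rewrite hs.
have hy3 : s * s * s * y = 3 * s * y by rewrite hs.
case: l; rewrite /= /GRing.scale /=; split; nra.
Qed.

Lemma thin_triangle_code beta j : thin_triangle (ifs_code beta j).
Proof.
elim: j beta => [|j IH] beta; last exact: thin_triangle_cell_map.
by rewrite /thin_triangle /=; split; lra.
Qed.

End CodedPoints.

(** * Disjointness of the limits over distinct sides *)

Section Separation.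
Context {R : realType}.
Implicit Types (x y t : R) (e : dart) (b : dir6) (n : nat).
Local Notation s3 := (Num.sqrt 3 : R).

Lemma coded_point_le (a b c : R) beta : `|a| <= 2 -> `|b| <= 2 ->
  (forall p, thin_triangle p -> a * p.1 + b * p.2 <= c) ->
  a * (coded_point beta).1 + b * (coded_point beta).2 <= c.
Proof.
move=> ha hb h; rewrite leNgt; apply/negP; rewrite -subr_gt0 => h0.
have [J hJ] := half_expr_small 8 h0.
have := h _ (@thin_triangle_code R beta J).
have [h1 h2] := (norm_leP _ _).1 (@coded_pointP R beta J).
move: h1 h2 hJ; set k1 := (coded_point beta).1; set k2 := (coded_point beta).2.
set c1 := (ifs_code beta J).1; set c2 := (ifs_code beta J).2.
set x := 2^-1 ^+ J => h1 h2 hJ h3.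
have k1' : a * (k1 - c1) <= 2 * (2 * x).
  apply: (le_trans (ler_norm _)); rewrite normrM; exact: ler_pM.
have k2' : b * (k2 - c2) <= 2 * (2 * x).
  apply: (le_trans (ler_norm _)); rewrite normrM; exact: ler_pM.
by move: hJ h3 k1' k2'; simpl; lra.
Qed.

(** The triangle is closed and contains the approximations. *)
Lemma thin_triangle_coded_point beta :
  thin_triangle (coded_point beta : plane R).
Proof.
have h2 := @sqrt3_lt2 R; have h0 := @sqrt3_gt0 R.
split.
- have := @coded_point_le 0 1 0 beta; rewrite mul0r add0r mul1r; apply.
  + by rewrite normr0.
  + by rewrite normr1 ler1n.
  + by move=> p [h _ _]; rewrite mul0r add0r mul1r.
- have k := @coded_point_le (-1) (- s3) 0 beta.
  suff : -1 * (coded_point beta).1 + - s3 * (coded_point beta).2 <= 0 by lra.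
  apply: k.
  + by rewrite normrN1 ler1n.
  + by rewrite normrN gtr0_norm // ltW.
  + by move=> p [_ h _]; lra.
- have k := @coded_point_le 1 (- s3) 1 beta.
  suff : 1 * (coded_point beta).1 + - s3 * (coded_point beta).2 <= 1 by lra.
  apply: k.
  + by rewrite normr1 ler1n.
  + by rewrite normrN gtr0_norm // ltW.
  + by move=> p [_ _ h]; lra.
Qed.

(** The four similarities of ratio 1/3 that refine the unit segment, in the
    order of [refine_dart]. *)
Definition child_map (k : nat) (p : plane R) : plane R :=
  match k with
  | 0%N => 3^-1 *: p
  | 1%N => cell_map true p
  | 2%N => cell_map false p
  | _ => (2 / 3, 0) + 3^-1 *: p
  end.

Definition child_side (k : nat) e : dart :=
  match k with
  | 0%N => first_third e | 1%N => cell_left e | 2%N => cell_right e | _ =>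
    last_third e
  end.

Lemma refine_dartP e e' :
  reflect (exists2 k, (k < 4)%N & e' = child_side k e) (e' \in refine_dart e).
Proof.
rewrite !inE; apply: (iffP or4P).
  case=> /eqP ->; by [exists 0%N|exists 1%N|exists 2%N|exists 3%N].
case=> -[|[|[|[|//]]]] _ ->.
- by constructor 1.
- by constructor 2.
- by constructor 3.
- by constructor 4.
Qed.

Lemma dart_frame_child n e k p :
  dart_frame n e (child_map k p) = dart_frame n.+1 (child_side k e) p.
Proof.
have h0 : dart_frame n e (3^-1 *: p) = dart_frame n.+1 (first_third e) p.
  rewrite /dart_frame /cmul /lattice_point scaleS.
  by apply: planeP; rewrite /= /GRing.scale /= !intrM; lra.
have h3 : dart_frame n e ((2 / 3, 0) + 3^-1 *: p) =
  dart_frame n.+1 (last_third e) p.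
  rewrite /dart_frame /cmul /lattice_point scaleS /last_third /unit_vector.
  by apply: planeP; rewrite /= /GRing.scale /= !intrD !intrM !rmorphMn /=
    ?step_xE ?step_yE; lra.
by case: k => [|[|[|k]]] //=;
  [rewrite (dart_frame_cell_map n e true)|rewrite
    (dart_frame_cell_map n e false)].
Qed.

(** In the coordinates (x, t) with y = sqrt 3 t the four maps have rational
    coefficients, so that linear arithmetic applies. *)
Definition child_x (k : nat) (x t : R) : R :=
  match k with
  | 0%N => x / 3 | 1%N => 1 / 3 + (x / 2 + 3 / 2 * t) / 3
  | 2%N => 1 / 2 + (x / 2 - 3 / 2 * t) / 3 | _ => 2 / 3 + x / 3
  end.
Definition child_t (k : nat) (x t : R) : R :=
  match k with
  | 0%N => t / 3 | 1%N => (t / 2 - x / 2) / 3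
  | 2%N => - (1 / 6) + (t / 2 + x / 2) / 3 | _ => t / 3
  end.

Lemma child_mapE k (x t : R) :
  child_map k (x, s3 * t) = (child_x k x t, s3 * child_t k x t).
Proof.
have hs := @sqrt3_sq R;
  rewrite /child_map /child_x /child_t /cell_map /cmul /unit_vector.
set s := Num.sqrt 3 in hs *; have ht : s * s * t = 3 * t by rewrite hs.
by case: k => [|[|[|k]]]; apply: planeP; rewrite /= /GRing.scale /=; lra.
Qed.

Lemma skew_y (p : plane R) : exists t, p = (p.1, s3 * t).
Proof.
exists (p.2 / s3); apply: planeP => //=.
by rewrite mulrC divfK // lt0r_neq0 ?sqrt3_gt0.
Qed.

Lemma thin_triangleE (x t : R) : thin_triangle (x, s3 * t) <->
  [/\ t <= 0, 0 <= x + 3 * t & x - 3 * t <= 1].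
Proof.
have hs := @sqrt3_sq R; have h0 := @sqrt3_gt0 R.
by rewrite /thin_triangle /= mulrA hs pmulr_rle0.
Qed.

Definition base_end (p : plane R) := p = (0, 0) \/ p = (1, 0).

Lemma base_endE (x t : R) : base_end (x, s3 * t) <->
  (t = 0 /\ (x = 0 \/ x = 1)).
Proof.
have h0 := lt0r_neq0 (@sqrt3_gt0 R); split.
  by case=> E; have := congr1 fst E; have /= /eqP := congr1 snd E;
    rewrite mulf_eq0 (negbTE h0) /= => /eqP -> ->; auto.
by case=> -> [->|->]; rewrite mulr0; [left|right].
Qed.

Lemma thin_triangle_child k p : thin_triangle p ->
  thin_triangle (child_map k p).
Proof.
have [t ->] := skew_y p; rewrite child_mapE !thin_triangleE => -[h1 h2 h3].
by case: k => [|[|[|k]]] /=; split; lra.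
Qed.

Lemma child_base_end k p : thin_triangle p -> base_end (child_map k p) ->
  base_end p.
Proof.
have [t ->] := skew_y p; rewrite child_mapE !thin_triangleE !base_endE =>
  -[h1 h2 h3].
case: k => [|[|[|k]]] /= -[E1 [E2|E2]];
  by first [exfalso; lra | split; [lra | first [left; lra | right; lra]]].
Qed.

Lemma siblings_base_end k k' p p' : thin_triangle p -> thin_triangle p' ->
  (k < 4)%N -> (k' < 4)%N ->
  k <> k' -> child_map k p = child_map k' p' -> base_end p.
Proof.
have [t ->] := skew_y p; have [t' ->] := skew_y p'.
rewrite !child_mapE !thin_triangleE base_endE =>
  -[h1 h2 h3] [h4 h5 h6] hk hk' kk' E.
have := congr1 fst E; have /= := congr1 snd E.
move/(mulfI (lt0r_neq0 (@sqrt3_gt0 R))).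
case: k hk kk' {E} => [|[|[|[|//]]]] _; case: k' hk' =>
  [|[|[|[|//]]]] _ //= _ E2 E1;
  by first [exfalso; lra | split; [lra | first [left; lra | right; lra]]].
Qed.

Lemma cmul_inj b (p q : plane R) : cmul (unit_vector b) p =
  cmul (unit_vector b) q -> p = q.
Proof.
move=> E; have h := @dot_unit_vector R b; move: E h; rewrite /dot.
set u := unit_vector b => E h.
have E1 := congr1 fst E; have E2 := congr1 snd E; rewrite /cmul /= in E1 E2.
have dec (w : plane R) : w.1 =
  u.1 * (u.1 * w.1 - u.2 * w.2) + u.2 * (u.1 * w.2 + u.2 * w.1).
  by rewrite -[LHS]mul1r -h; ring.
have dec2 (w : plane R) : w.2 =
  u.1 * (u.1 * w.2 + u.2 * w.1) - u.2 * (u.1 * w.1 - u.2 * w.2).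
  by rewrite -[LHS]mul1r -h; ring.
by apply: planeP; [rewrite dec E1 E2 -dec | rewrite dec2 E1 E2 -dec2].
Qed.

Lemma dart_frame_inj n e : injective (@dart_frame R n e).
Proof.
move=> p q /addrI /(scalerI (lt0r_neq0 (scale_gt0 n))).
exact: cmul_inj.
Qed.

(** By induction on the level: the triangles over the four parts of a side lie
    in the triangle over that side and touch each other only at end points,
    and an end point of a large side that lies in the triangle over a part is
    an end point of that part. *)
Lemma thin_triangle_separation n e e' p p' : e \in side_darts n ->
  e' \in side_darts n -> e <> e' ->
  thin_triangle p -> thin_triangle p' -> dart_frame n e p =
    dart_frame n e' p' -> base_end p.
Proof.
elim: n e e' p p' => [|n IH] e e' p p'.
  have [t ->] := skew_y p; have [t' ->] := skew_y p'.
  rewrite !inE base_endE !thin_triangleE => he he' ee' [h1 h2 h3] [h4 h5 h6] E.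
  have hs := @sqrt3_sq R; have h0 := @sqrt3_gt0 R.
  have ht : s3 * s3 * t = 3 * t by rewrite hs.
  have ht' : s3 * s3 * t' = 3 * t' by rewrite hs.
  have hx : s3 * s3 * p.1 = 3 * p.1 by rewrite hs.
  have hx' : s3 * s3 * p'.1 = 3 * p'.1 by rewrite hs.
  (* the ordinates are multiplied by sqrt 3 to become rational combinations *)
  have E1 := congr1 fst E; have E2 := congr1 (fun q => s3 * q.2) E.
  case/or3P: he ee' E1 E2 {E} => /eqP ->; case/or3P: he' => /eqP -> // _;
    rewrite /dart_frame /cmul /lattice_point /unit_vector /= /GRing.scale /=
      expr0 invr1 !mul1r => F1 F2;
    by first [exfalso; lra | split; [lra | first [left; lra | right; lra]]].
move=> /flatten_mapP[s hs /refine_dartP[k k4 ->]]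
  /flatten_mapP[s' hs' /refine_dartP[k' k4' ->]].
move=> ee' tp tp'; rewrite -!dart_frame_child => E.
have [ss|/eqP ss] := eqVneq s s'.
  rewrite -ss in E ee'; move/dart_frame_inj: E; apply: siblings_base_end =>
    // kk.
  by apply: ee'; rewrite kk.
have := IH s s' _ _ hs hs' ss (thin_triangle_child k tp)
  (thin_triangle_child k' tp') E.
exact: child_base_end.
Qed.

End Separation.

(** * The attractor and its isometric copies *)

Section SelfSimilarity.
Context {R : realType}.
Implicit Types (x y t : R) (e : dart) (b : dir6) (n : nat).
Local Notation s3 := (Num.sqrt 3 : R).

(** A coded point lies over a cell side, away from the two ends of the
    segment. *)
Lemma coded_point_not_end beta : ~ base_end (coded_point beta : plane R).
Proof.
rewrite coded_point_cons; have := @thin_triangle_coded_point R (bit_tail beta).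
set p := coded_point _; have [t ->] := skew_y p.
rewrite thin_triangleE => -[h1 h2 h3].
case: (beta 0%N).
  rewrite -[cell_map true _]/(child_map 1 (p.1, s3 * t)) child_mapE base_endE
    /=.
  by case=> E [E'|E']; lra.
rewrite -[cell_map false _]/(child_map 2 (p.1, s3 * t)) child_mapE base_endE /=.
by case=> E [E'|E']; lra.
Qed.

Lemma coded_point_dart_inj n e e' beta gamma : e \in side_darts n ->
  e' \in side_darts n ->
  dart_frame n e (coded_point beta) =
    dart_frame n e' (coded_point gamma) :> plane R -> e = e'.
Proof.
move=> he he' E; apply/eqP; apply: contraT => /eqP ee'; exfalso.
apply: (@coded_point_not_end beta).
exact: (thin_triangle_separation he he' ee' (@thin_triangle_coded_point R _)
  (@thin_triangle_coded_point R _) E).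
Qed.

Lemma path_side_boundary n e beta j : boundary n e ->
  boundary (n + j) (path_side e beta j).
Proof.
move=> he; elim: j => [|j IH]; first by rewrite addn0.
rewrite addnS /=; apply: (boundary_refine IH); rewrite /cell_side.
by case: (beta j); case: (mem_refine_dart (path_side e beta j)).
Qed.

(** At each level the limit lies in the triangle over the side of that level,
    not at an end, which determines the side. *)
Lemma coded_point_path n e e' beta gamma : boundary n e -> boundary n e' ->
  dart_frame n e (coded_point beta) =
    dart_frame n e' (coded_point gamma) :> plane R ->
  forall j, path_side e beta j = path_side e' gamma j.
Proof.
move=> he he' E j; move: E;
  rewrite (dart_frame_coded_point n e beta j)
    (dart_frame_coded_point n e' gamma j).
by apply: coded_point_dart_inj; rewrite mem_side_darts;
  apply: path_side_boundary.
Qed.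

Lemma path_side_inj e e' beta gamma :
  (forall j, path_side e beta j = path_side e' gamma j) -> e = e' /\ beta =
    gamma.
Proof.
move=> h; split; first exact: (h 0%N).
apply/funext => j; have := h j.+1; rewrite /= (h j) /cell_side.
case: (beta j); case: (gamma j) => // E.
- by move: (cell_left_neq_right (path_side e' gamma j)); rewrite E eqxx.
- by move: (cell_left_neq_right (path_side e' gamma j)); rewrite -E eqxx.
Qed.

Lemma coded_point_continuous :
  continuous (coded_point : cantor_space -> plane R).
Proof.
move=> beta; apply/cvgrPdist_lt => eps e0.
have [J hJ] := half_expr_small 4 e0.
apply: filterS (cylinder_nbhs beta J) => gamma h.
exact: le_lt_trans (coded_point_close h) hJ.
Qed.

Lemma lipschitz_continuous (g : plane R -> plane R) (c : R) :
  (forall p q, `|g p - g q| <= c * `|p - q|) -> continuous g.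
Proof.
move=> h p; apply/cvgrPdist_lt => eps e0.
have c0 : 0 < `|c| + 1 by rewrite ltr_wpDl.
have d0 : 0 < eps / (`|c| + 1) by rewrite divr_gt0.
near=> q.
have : `|p - q| < eps / (`|c| + 1).
  by near: q; exact: (@cvgr_dist_lt _ _ _ (nbhs p) _ id p _ _ d0).
rewrite ltr_pdivlMr // => hq; apply: (le_lt_trans (h p q)).
apply: le_lt_trans hq; rewrite mulrC; apply: ler_wpM2l => //.
by apply: (le_trans (ler_norm c)); rewrite lerDl.
Unshelve. all: by end_near. Qed.

(** The cell maps of a segment of length [h]: the copies at level N are
    isometric to the attractor of these maps with h = 3^-N. *)
Definition scaled_cell_map (h : R) (l : bool) (p : plane R) : plane R :=
  h *: cell_map l (h^-1 *: p).

Lemma dot_cmul b (p : plane R) :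
  dot (cmul (unit_vector b) p) (cmul (unit_vector b) p) = dot p p.
Proof.
have h := @dot_unit_vector R b;
  transitivity (dot (unit_vector b) (unit_vector b) * dot p p);
    last by rewrite h mul1r.
by rewrite /dot /cmul /=; ring.
Qed.

Lemma edist_similarity (a p q : plane R) b (c : R) : 0 <= c ->
  Defs.edist (a + c *: cmul (unit_vector b) p)
    (a + c *: cmul (unit_vector b) q) = c * Defs.edist p q.
Proof.
move=> c0; rewrite /Defs.edist.
have -> : a + c *: cmul (unit_vector b) p - (a + c *: cmul (unit_vector b) q) =
  c *: cmul (unit_vector b) (p - q).
  rewrite opprD addrACA subrr add0r -scalerBr; congr (_ *: _).
  by apply: planeP; rewrite /cmul /=; ring.
have -> (v : plane R) : dot (c *: v) (c *: v) = c ^+ 2 * dot v v.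
  by rewrite /dot /= /GRing.scale /=; ring.
by rewrite dot_cmul sqrtrM ?sqr_ge0 // sqrtr_sqr ger0_norm.
Qed.

Lemma scaled_cell_mapE h l (p : plane R) : h != 0 -> scaled_cell_map h l p =
  h *: (if l then (1 / 3, 0) else (1 / 2, - (s3 / 6))) + 3^-1 *: cmul
    (unit_vector (if l then D5 else D1)) p.
Proof.
move=> h0; rewrite /scaled_cell_map /cell_map scalerDr; congr (_ + _).
by apply: planeP; rewrite /cmul /= /GRing.scale /=; field.
Qed.

Lemma scaled_cell_map_similarity h l : h != 0 ->
  contractive_similarity (scaled_cell_map h l).
Proof.
move=> h0; exists 3^-1; first by apply/andP; split; lra.
by move=> p q; rewrite !scaled_cell_mapE // edist_similarity // invr_ge0.
Qed.

Lemma scaled_cell_map_lip h l (p q : plane R) : 0 < h ->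
  `|scaled_cell_map h l p - scaled_cell_map h l q| <= 2^-1 * `|p - q|.
Proof.
move=> h0; rewrite /scaled_cell_map -scalerBr normrZ gtr0_norm //.
have := cell_map_lip l (h^-1 *: p) (h^-1 *: q).
rewrite -scalerBr normrZ gtr0_norm ?invr_gt0 // => H.
apply: (le_trans (ler_wpM2l (ltW h0) H)).
by rewrite mulrCA mulVKf // gt_eqF.
Qed.

Lemma scaled_cell_map_scale h l (p : plane R) : h != 0 ->
  scaled_cell_map h l (h *: p) = h *: cell_map l p.
Proof. by move=> h0; rewrite /scaled_cell_map scalerK. Qed.

Definition scaled_IFS h (i : 'I_2) : plane R -> plane R :=
  scaled_cell_map h (i == ord0).

(** Pulling a point of [K1] back by the maps [n] times and pushing any point
    of [K2] forward by the same maps gives a point of [K2] at distance at most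
    C / 2^n. *)
Lemma scaled_IFS_fixed_sub h K1 K2 : 0 < h -> IFS_fixed (scaled_IFS h) K1 ->
  IFS_fixed (scaled_IFS h) K2 ->
  K1 `<=` K2.
Proof.
move=> h0 [_ c1 E1] [[y0 Ky0] c2 E2].
have [M1 [_ /(_ (`|M1| + 1)) hM1]] := compact_bounded c1.
have [M2 [_ /(_ (`|M2| + 1)) hM2]] := compact_bounded c2.
have l1 (M : R) : M < `|M| + 1 by apply: (le_lt_trans (ler_norm M));
  rewrite ltrDl.
set C := (`|M1| + 1) + (`|M2| + 1).
have near_K2 n : forall x : plane R, K1 x -> exists2 y : plane R,
  K2 y & `|x - y| <= C * 2^-1 ^+ n.
  elim: n => [|n IH] x Kx.
    exists y0 => //; rewrite expr0 mulr1; apply: (le_trans (ler_normB _ _)).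
    by apply: lerD; [exact: (hM1 (l1 _) x Kx)|exact: (hM2 (l1 _) y0 Ky0)].
  move: Kx; rewrite {1}E1 => -[i _ [x' Kx' <-]].
  have [y' Ky' hy'] := IH _ Kx'; exists (scaled_IFS h i y').
    by rewrite E2; exists i => //; exists y'.
  apply: (le_trans (scaled_cell_map_lip _ _ _ h0)); rewrite exprS mulrCA.
  by rewrite ler_pM2l // invr_gt0.
move=> x Kx; have cl := compact_closed (@norm_hausdorff _ _) c2.
apply: cl => U /nbhs_ballP[eps /= e0 hU].
have [n hn] := half_expr_small C e0.
have [y Ky hy] := near_K2 n x Kx.
exists y; split=> //; apply: hU; rewrite -ball_normE /=.
exact: le_lt_trans hn.
Qed.

Definition limit_set (h : R) : set (plane R) :=
  range (fun beta : cantor_space => h *: coded_point beta).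

Lemma limit_set_fixed h : 0 < h -> IFS_fixed (scaled_IFS h) (limit_set h).
Proof.
move=> h0; have hn0 : h != 0 by rewrite gt_eqF.
split.
- by exists (h *: coded_point point); exists point.
- apply: continuous_compact; last exact: cantor_space_compact.
  apply: continuous_subspaceT => beta.
  apply: (@continuous_comp _ _ _ (coded_point : cantor_space -> plane R)
    (fun p => h *: p)).
    exact: coded_point_continuous.
  by apply: (@lipschitz_continuous (fun p => h *: p) `|h|) => p q;
    rewrite -scalerBr normrZ.
- apply/seteqP; split=> [_ [beta _ <-]|_ [i _ [_ [beta _ <-] <-]]].
    exists (if beta 0%N then ord0 else ord_max) => //.
    exists (h *: coded_point (bit_tail beta)); first by exists (bit_tail beta).
    rewrite /scaled_IFS (scaled_cell_map_scale _ _ hn0)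
      [in RHS]coded_point_cons.
    by case: (beta 0%N).
  pose gamma : cantor_space := fun j =>
    if j is j'.+1 then beta j' else i == ord0.
  exists gamma => //.
  by rewrite coded_point_cons /scaled_IFS (scaled_cell_map_scale _ _ hn0).
Qed.

(** Uniqueness follows from [scaled_IFS_fixed_sub] applied in both directions.
    *)
Lemma limit_set_attractor h : 0 < h -> attractor (limit_set h).
Proof.
move=> h0; exists 2%N, (scaled_IFS h); split.
- by move=> i; apply: scaled_cell_map_similarity; rewrite gt_eqF.
- exact: limit_set_fixed.
- move=> K' hK'; have hK := limit_set_fixed h0.
  by apply/seteqP; split; apply: (scaled_IFS_fixed_sub h0).
Qed.

(** The frame of a side, without its scaling. *)
Definition frame_isometry n e (p : plane R) : plane R :=
  lattice_point n e.1.1%:~R e.1.2%:~R + cmul (unit_vector e.2) p.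

Lemma frame_isometryP n e : plane_isometry (frame_isometry n e).
Proof.
move=> p q; rewrite /frame_isometry.
by rewrite -[cmul _ p]scale1r -[cmul _ q]scale1r edist_similarity ?mul1r.
Qed.

Lemma frame_isometryE n e (p : plane R) : frame_isometry n e (3 ^- n *: p) =
  dart_frame n e p.
Proof.
rewrite /frame_isometry /dart_frame; congr (_ + _).
by apply: planeP; rewrite /cmul /= /GRing.scale /=; ring.
Qed.

End SelfSimilarity.

(** * Cantor structure and self-similarity of the footprint *)

(** A periodic orbit is finite; a list without repetition indexes the copies.
    *)
Lemma orbit_list n e P : (0 < P)%N -> side_orbit n e P = e ->
  exists l : seq dart, [/\ uniq l, (0 < size l)%N &
    forall e', e' \in l <-> exists k, e' = side_orbit n e k].
Proof.
move=> P0 hP; exists (undup (mkseq (side_orbit n e) P)); split.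
- exact: undup_uniq.
- case: P P0 hP => // P _ _.
  have : side_orbit n e 0 \in undup (mkseq (side_orbit n e) P.+1).
    by rewrite mem_undup; apply/mapP; exists 0%N; rewrite ?mem_iota.
  by case: (undup _).
- move=> e'; rewrite mem_undup; split=> [/mapP[k _ ->]|[k ->]];
  first by exists k.
  apply/mapP; exists (k %% P)%N; first by rewrite mem_iota ltn_mod.
  rewrite {1}(divn_eq k P); elim: (k %/ P)%N => // q IH.
  by rewrite -IH mulSn -addnA addnC /side_orbit iterD -/(side_orbit n e P) hP.
Qed.

Theorem theorem5p5 (R : realType) (z0 : nat -> state R) (N : nat)
    (hz0 : compatible_piecewise_Fagnano z0 N) :
  cantor_set (footprint z0 N) /\
  [/\ (forall om, footprint z0 N om ->
         exists2 p, realized_at om p & koch_snowflake p),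
      (forall om om' p, footprint z0 N om -> footprint z0 N om' ->
         realized_at om p -> realized_at om' p -> om = om'),
      cantor_set (planar_footprint z0 N) &
      self_similar (planar_footprint z0 N)].
Proof.
have [e0 he0 hinit] := initial_darts hz0.
have [_ hper _ _ _] := hz0.
have hcomp := let: And5 h _ _ _ _ := hz0 in h.
have [P P0 hP] : exists2 P, (0 < P)%N & side_orbit N e0 P = e0.
  have [[P P0 hP] _] := hper N; exists P => //.
  have E0 := hinit 0%N; rewrite addn0 /= in E0.
  by move: hP; rewrite E0 orbit_pointE // => /phase_state_inj.
have [l [lu l0 hl]] := orbit_list P0 hP.
have tinj : injective (tnth (in_tuple l)) by exact/tuple_uniqP.
have fpP om : footprint z0 N om <-> exists2 e, e \in l &
    exists beta, forall j, om j = phase_state (N + j) (path_side e beta j).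
  rewrite (footprintP he0 hinit P0 hP); split=> -[e he hb]; exists e => //.
    by apply/hl; case: he => k ->; exists k; rewrite addn0.
  by have [k ->] := (hl e).1 he; exists k; rewrite addn0.
have lb e : e \in l -> boundary N e.
  by move=> /hl[k ->]; exact: boundary_orbit.
have realE (om : nat -> state R) e (beta : nat -> bool) p :
    (forall j, om j = phase_state (N + j) (path_side e beta j)) ->
    realized_at om p <-> p = dart_frame N e (coded_point beta).
  move=> h; have h' : realized_at om (dart_frame N e (coded_point beta)).
    have E : (fun j => (om j).1) =
      (fun j => dart_midpoint (N + j) (path_side e beta j)).
      by apply/funext => j; rewrite h.
    by rewrite /realized_at E; exact: dart_path_limit.
  split=> [hp|-> //].
  exact: (cvg_unique (@norm_hausdorff _ _) hp h').
have plE : planar_footprint z0 N =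
    \bigcup_(i in [set: 'I_(size l)]) range
      (fun beta : cantor_space =>
        dart_frame N (tnth (in_tuple l) i) (coded_point beta)).
  apply/seteqP; split=> [p [om /fpP[e he [beta hb]] /(realE _ _ _ _ hb) ->]|p].
    have /seq_tnthP[i Ei] := he.
    by exists i => //; exists beta => //; rewrite Ei.
  move=> [i _ [beta _ <-]]; set e := tnth _ i.
  exists (fun j => phase_state (N + j) (path_side e beta j));
    last by apply/realE.
  by apply/fpP; exists e; [rewrite /e mem_tnth | exists beta].
have frame_inj' (i j : 'I_(size l)) (beta gamma : cantor_space) :
    dart_frame N (tnth (in_tuple l) i) (coded_point beta) =
      dart_frame N (tnth (in_tuple l) j) (coded_point gamma) :> plane R ->
    i = j /\ beta = gamma.
  move=> E; have bi := lb _ (mem_tnth i (in_tuple l)); have bj :=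
    lb _ (mem_tnth j (in_tuple l)).
  by have [/tinj ij bg] := path_side_inj (coded_point_path bi bj E).
have fpE : footprint z0 N = \bigcup_(i in [set: 'I_(size l)])
   range (fun beta : cantor_space =>
     (fun j => phase_state (N + j) (path_side (tnth (in_tuple l) i) beta j)) :
     prod_topology (fun _ : nat => discrete_topology (state R))).
  apply/seteqP; split=> [om /fpP[e he [beta hb]]|om [i _ [beta _ <-]]].
    have /seq_tnthP[i Ei] := he.
    by exists i => //; exists beta => //; apply/funext => j; rewrite hb Ei.
  by apply/fpP; exists (tnth (in_tuple l) i); [rewrite mem_tnth | exists beta].
have fp_cantor : cantor_set (footprint z0 N).
  rewrite fpE; apply: cantor_set_bigcup => //.
  - apply: hausdorff_product => x; exact: discrete_hausdorff.
  - move=> i; apply: discrete_valued_continuous => j beta gamma h.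
    congr phase_state; elim: j h => //= j IH h.
    by rewrite h // IH // => k kj; apply: h; apply: ltnW.
  - move=> i beta j gamma E.
    have [] := @path_side_inj (tnth (in_tuple l) i) (tnth (in_tuple l) j) beta
      gamma.
      move=> k; exact: (@phase_state_inj R (N + k) _ _
        (congr1 (fun om => om k) E)).
    by move=> /tinj.
split=> //; split.
- move=> om /fpP[e he [beta hb]].
  exists (dart_frame N e (coded_point beta)); first exact/(realE _ _ _ _ hb).
  (* below level N any points of the polygons will do *)
  exists (fun n => if (n < N)%N then (z0 n).1 else (om (n - N)%N).1).
    move=> n; case: ltnP => nN.
      by have [_ _ []] := hcomp n.
    rewrite hb subnKC //=; apply: dart_midpoint_in_KS; rewrite mem_side_darts.
    by rewrite -{1}(subnKC nN); apply: path_side_boundary; apply: lb.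
  have hom := (realE _ _ _ _ hb).2 erefl.
  have hN : (om (n - N)%N).1 @[n --> \oo] --> dart_frame N e (coded_point beta).
    exact: cvg_comp (@cvg_subnr N) hom.
  apply: cvg_trans hN; apply: near_eq_cvg; exists N => // n /= Nn.
  by rewrite ltnNge Nn.
- move=> om om' p /fpP[e he [beta hb]] /fpP[e' he' [gamma hg]].
  move=> /(realE _ _ _ _ hb) E /(realE _ _ _ _ hg) E'.
  apply/funext => j; rewrite hb hg; congr phase_state.
  by apply: (@coded_point_path R N); [exact: lb|exact: lb|rewrite -E -E'].
- rewrite plE; apply: cantor_set_bigcup => //.
  + move=> i beta.
    apply: (@continuous_comp _ _ _ (coded_point : cantor_space -> plane R)
      (dart_frame N (tnth (in_tuple l) i))).
      exact: coded_point_continuous.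
    by apply: (@lipschitz_continuous R _ 2) => p q; exact: dart_frame_lip.
  + by move=> i beta j gamma /frame_inj'.
right; exists (limit_set (3 ^- N)).
  by apply: limit_set_attractor; exact: scale_gt0.
exists (size l), (fun i => frame_isometry N (tnth (in_tuple l) i)); split.
- by move=> i; exact: frame_isometryP.
- rewrite plE; apply: eq_bigcupr => i _; apply/seteqP;
  split=> [_ [beta _ <-]|_ [_ [beta _ <-] <-]].
    by exists (3 ^- N *: coded_point beta);
      [exists beta | rewrite frame_isometryE].
  by exists beta => //; rewrite frame_isometryE.
- move=> i j ij p q [[_ [beta _ <-] <-] [_ [gamma _ <-] E]] _.
  exfalso; move: E; rewrite !frame_isometryE => /frame_inj'[ji _].
  by rewrite ji eqxx in ij.
Qed.
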